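(* Let $\eta \geq \frac{2\log(16 n^2 d^2) + 16|\mathcal{E}| d^2}{\min(\Delta, \frac{1}{128})}$ and let $\epsilon^{-1} > (25 d \deg(\mathcal{G}) |\mathcal{E}|)^2 \max\left(\eta \|C\|_\infty, 68\right)$. If $\mathbb{L}_2$ is tight and $|\mathcal{V}^*_2| = 1$, then the EMP algorithm (run with inputs $C,\eta,\epsilon$) returns a MAP assignment after $\left\lceil \frac{4\mathcal{S}_0(\deg(\mathcal{G})+1)}{\epsilon^2} \right\rceil$ iterations for EMP-cyclic and after $\left\lceil \frac{4\mathcal{S}_0}{\epsilon^2} \right\rceil$ iterations for EMP-greedy.
   Context: Pairwise graphical model on $\mathcal{G}=(\mathcal{V},\mathcal{E})$ with $\mathcal{V}=\{1,\dots,n\}$, every vertex having at least one edge, states $\chi=\{0,\dots,d-1\}$, potentials $\theta_i(x_i)$, $\theta_{ij}(x_i,x_j)$; MAP inference is $\max_{x\in\chi^n}\sum_i\theta_i(x_i)+\sum_{ij}\theta_{ij}(x_i,x_j)$. A marginal vector $\Gamma$ consists of vectors $\Gamma_i\in\mathbb{R}_+^d$ and matrices $\Gamma_{ij}\in\mathbb{R}_+^{d\times d}$. The local polytope is $\mathbb{L}_2=\{\Gamma\ge 0: \Gamma_i\in\Sigma_d\ \forall i,\ \Gamma_{ij}\mathbbm{1}=\Gamma_i,\ \Gamma_{ij}^\top\mathbbm{1}=\Gamma_j\ \forall ij\}$, where $\Sigma_d$ is the probability simplex. Let $C=-\theta$. The LP relaxation is $\min\langle C,\Gamma\rangle$ over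 $\mathbb{L}_2$; $\mathbb{L}_2$ is called tight if this LP has an integral optimal solution. $\mathcal{V}_2$ is the set of vertices of $\mathbb{L}_2$, $\mathcal{V}^*_2$ the set of optimal vertices w.r.t. $C$, and $\Delta=\min_{V_1\in\mathcal{V}_2\setminus\mathcal{V}_2^*,V_2\in\mathcal{V}_2^*}\langle C,V_1\rangle-\langle C,V_2\rangle$. The entropy-regularized problem is $\min_{\Gamma\in\mathbb{L}_2}\langle C,\Gamma\rangle-\frac1\eta H(\Gamma)$ with $H(\Gamma)=\langle\Gamma,-\log\Gamma+\mathbbm{1}\rangle$, equivalently the Bregman (KL) projection of $\exp(-\eta C)$ onto $\mathbb{L}_2$. EMP (edge-based message passing) initializes $\Gamma$ as $\exp(-\eta C)$ with each vertex and edge component normalized to sum to one, and for an edge $ij$ applies closed-form Bregman projections: left consistency $\Gamma_{ij}(x_i,x_j)\leftarrow\Gamma_{ij}(x_i,x_j)\sqrt{\Gamma_i(x_i)/\sum_x\Gamma_{ij}(x_i,x)}$, $\Gamma_i(x_i)\leftarrow\Gamma_i(x_i)\sqrt{\sum_x\Gamma_{ij}(x_i,x)/\Gamma_i(x_i)}$; left normalization (normalize $\Gamma_i$ and $\Gamma_{ij}$ to sum to one); and the analogous right consistency/normalization with columns and vertex $j$. EMP-cyclic, in each iteration, applies left consistency, left normalization, right consistency, right normalization to every edge in order; EMP-greedy, in each iteration, picks the edge and side with the largest violation $\max\{\|\Gamma_{ij}\mathbbm{1}-\Gamma_i\|_1,\|\Gamma_{ij}^\top\mathbbm{1}-\Gamma_j\|_1\}$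 and applies that side's consistency then normalization. Both stop once all violations $\|\Gamma_{ij}\mathbbm{1}-\Gamma_i\|_1$, $\|\Gamma_{ij}^\top\mathbbm{1}-\Gamma_j\|_1$ are below $\epsilon$, and return the rounding $x_i=\arg\max_x\Gamma_i(x)$. $\deg(\mathcal{G})$ is the maximum degree. $\mathcal{S}_0=\min(\|\eta C/d+\exp(-\eta C)\|_1, S)$ with $S=\sum_{ij\in\mathcal{E}}[\log\sum_{x_i,x_j}e^{-\eta C_{ij}(x_i,x_j)}+\sum_{x_i,x_j}\frac{\eta}{d^2}C_{ij}(x_i,x_j)]+\sum_{i\in\mathcal{V}}[\log\sum_x e^{-\eta C_i(x)}+\sum_x\frac{\eta}{d}C_i(x)]$. *)

(* Defs.v *)
From HB Require Import structures.
From mathcomp Require Import all_boot all_order all_algebra.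
From mathcomp Require Import all_classical all_reals all_analysis.
Set Implicit Arguments. Unset Strict Implicit. Unset Printing Implicit Defensive.
Import Order.TTheory GRing.Theory Num.Theory.
Local Open Scope ring_scope.
Local Open Scope classical_set_scope.

(* Pairwise graphical model on the graph with vertices 'I_n, edges 'I_m,
   edge e = (src e, dst e) (the pair ij with i = src e, j = dst e),
   states 'I_d = {0,...,d-1}. *)

Section EMP.
Variables (R : realType) (n d m : nat).
Variables (src dst : 'I_m -> 'I_n).

(* A marginal vector (also used for cost vectors C = -theta):
   vertex components Gamma_i(x) and edge components Gamma_ij(x_i,x_j). *)
Record marg := Marg {
  mv : 'I_n -> 'I_d -> R ;
  me : 'I_m -> 'I_d -> 'I_d -> R }.

Definition simple_graph : Prop :=
  (forall e, src e != dst e) /\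
  (forall e f, (src e = src f /\ dst e = dst f) \/ (src e = dst f /\ dst e = src f)
               -> e = f) /\
  (forall i, exists e, src e = i \/ dst e = i).

Definition inner (C G : marg) : R :=
  \sum_(i < n) \sum_(x < d) mv C i x * mv G i x
  + \sum_(e < m) \sum_(x < d) \sum_(y < d) me C e x y * me G e x y.

Definition rowsum (G : marg) (e : 'I_m) (x : 'I_d) : R := \sum_(y < d) me G e x y.
Definition colsum (G : marg) (e : 'I_m) (y : 'I_d) : R := \sum_(x < d) me G e x y.

Definition in_L2 (G : marg) : Prop :=
  (forall i x, 0 <= mv G i x) /\ (forall e x y, 0 <= me G e x y) /\
  (forall i, \sum_(x < d) mv G i x = 1) /\
  (forall e x, rowsum G e x = mv G (src e) x) /\
  (forall e y, colsum G e y = mv G (dst e) y).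

Definition mix (t : R) (A B : marg) : marg :=
  Marg (fun i x => t * mv A i x + (1 - t) * mv B i x)
       (fun e x y => t * me A e x y + (1 - t) * me B e x y).

Definition is_vertex (G : marg) : Prop :=
  in_L2 G /\
  forall A B t, in_L2 A -> in_L2 B -> 0 < t < 1 -> G = mix t A B -> A = B.

Definition lp_optimal (C G : marg) : Prop :=
  in_L2 G /\ forall H, in_L2 H -> inner C G <= inner C H.

Definition integral (G : marg) : Prop :=
  (forall i x, mv G i x \is a Num.int) /\ (forall e x y, me G e x y \is a Num.int).

Definition tight (C : marg) : Prop := exists G, lp_optimal C G /\ integral G.

Definition opt_vertex (C G : marg) : Prop := is_vertex G /\ lp_optimal C G.

Definition unique_opt_vertex (C : marg) : Prop :=
  exists G, opt_vertex C G /\ forall H, opt_vertex C H -> H = G.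

Definition Delta (C : marg) : R :=
  inf [set r | exists V1 V2, is_vertex V1 /\ ~ opt_vertex C V1 /\
                            opt_vertex C V2 /\ r = inner C V1 - inner C V2].

Definition deg (i : 'I_n) : nat := #|[set e : 'I_m | (src e == i) || (dst e == i)]|.
Definition maxdeg : nat := \max_(i < n) deg i.

Definition normInf (C : marg) : R :=
  Num.max (\big[Num.max/0]_(i < n) \big[Num.max/0]_(x < d) `|mv C i x|)
          (\big[Num.max/0]_(e < m) \big[Num.max/0]_(x < d) \big[Num.max/0]_(y < d)
              `|me C e x y|).

Definition norm1_init (C : marg) (eta : R) : R :=
  \sum_(i < n) \sum_(x < d) `|eta * mv C i x / d%:R + expR (- (eta * mv C i x))|
  + \sum_(e < m) \sum_(x < d) \sum_(y < d)
       `|eta * me C e x y / d%:R + expR (- (eta * me C e x y))|.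

Definition S_quant (C : marg) (eta : R) : R :=
  \sum_(e < m) (ln (\sum_(x < d) \sum_(y < d) expR (- (eta * me C e x y)))
                + \sum_(x < d) \sum_(y < d) eta / (d%:R ^+ 2) * me C e x y)
  + \sum_(i < n) (ln (\sum_(x < d) expR (- (eta * mv C i x)))
                + \sum_(x < d) eta / d%:R * mv C i x).

Definition S0 (C : marg) (eta : R) : R := Num.min (norm1_init C eta) (S_quant C eta).

Definition emp_init (C : marg) (eta : R) : marg :=
  Marg (fun i x => expR (- (eta * mv C i x)) / \sum_(y < d) expR (- (eta * mv C i y)))
       (fun e x y => expR (- (eta * me C e x y)) /
                     \sum_(x' < d) \sum_(y' < d) expR (- (eta * me C e x' y'))).

Definition upd_v (G : marg) (i : 'I_n) (f : 'I_d -> R) : marg :=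
  Marg (fun i' => if i' == i then f else mv G i') (me G).
Definition upd_e (G : marg) (e : 'I_m) (f : 'I_d -> 'I_d -> R) : marg :=
  Marg (mv G) (fun e' => if e' == e then f else me G e').

Definition left_cons (G : marg) (e : 'I_m) : marg :=
  let i := src e in
  upd_v (upd_e G e (fun x y => me G e x y * Num.sqrt (mv G i x / rowsum G e x))) i
        (fun x => mv G i x * Num.sqrt (rowsum G e x / mv G i x)).

Definition right_cons (G : marg) (e : 'I_m) : marg :=
  let j := dst e in
  upd_v (upd_e G e (fun x y => me G e x y * Num.sqrt (mv G j y / colsum G e y))) j
        (fun y => mv G j y * Num.sqrt (colsum G e y / mv G j y)).

Definition normalize_e (G : marg) (e : 'I_m) : marg :=
  upd_e G e (fun x y => me G e x y / \sum_(x' < d) \sum_(y' < d) me G e x' y').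
Definition normalize_v (G : marg) (i : 'I_n) : marg :=
  upd_v G i (fun x => mv G i x / \sum_(y < d) mv G i y).

Definition left_norm (G : marg) (e : 'I_m) : marg := normalize_e (normalize_v G (src e)) e.
Definition right_norm (G : marg) (e : 'I_m) : marg := normalize_e (normalize_v G (dst e)) e.

Definition left_step (G : marg) (e : 'I_m) : marg := left_norm (left_cons G e) e.
Definition right_step (G : marg) (e : 'I_m) : marg := right_norm (right_cons G e) e.

Definition cyclic_iteration (G : marg) : marg :=
  foldl (fun G e => right_step (left_step G e) e) G (enum 'I_m).

Definition cyclic_traj (C : marg) (eta : R) (t : nat) : marg :=
  iter t cyclic_iteration (emp_init C eta).

Definition viol_left (G : marg) (e : 'I_m) : R :=
  \sum_(x < d) `|rowsum G e x - mv G (src e) x|.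
Definition viol_right (G : marg) (e : 'I_m) : R :=
  \sum_(y < d) `|colsum G e y - mv G (dst e) y|.

(* one iteration of EMP-greedy (ties broken arbitrarily):
   side = false is the left side, side = true the right side *)
Definition greedy_iteration (G G' : marg) : Prop :=
  exists (e : 'I_m) (side : bool),
    (forall f, Num.max (viol_left G f) (viol_right G f)
               <= (if side then viol_right G e else viol_left G e)) /\
    G' = (if side then right_step G e else left_step G e).

Definition greedy_traj (C : marg) (eta eps : R) (traj : nat -> marg) : Prop :=
  traj 0%N = emp_init C eta /\
  forall t, ~ (forall e, viol_left (traj t) e < eps /\ viol_right (traj t) e < eps) ->
            greedy_iteration (traj t) (traj t.+1).

Definition stopped (eps : R) (G : marg) : Prop :=
  forall e, viol_left G e < eps /\ viol_right G e < eps.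

Definition is_rounding (G : marg) (x : 'I_n -> 'I_d) : Prop :=
  forall i y, mv G i y <= mv G i (x i).

(* MAP assignment for theta = - C *)
Definition map_objective (C : marg) (x : 'I_n -> 'I_d) : R :=
  \sum_(i < n) (- mv C i (x i)) + \sum_(e < m) (- me C e (x (src e)) (x (dst e))).
Definition is_MAP (C : marg) (x : 'I_n -> 'I_d) : Prop :=
  forall y, map_objective C y <= map_objective C x.

Definition returns_MAP_within (C : marg) (eps : R) (traj : nat -> marg) (K : R) : Prop :=
  exists t : nat, (t%:Z <= Num.ceil K)%R /\ stopped eps (traj t) /\
    (forall s, (s < t)%N -> ~ stopped eps (traj s)) /\
    (forall x, is_rounding (traj t) x -> is_MAP C x).

End EMP.

(* Main.v *)
Require Import Defs.
From HB Require Import structures.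
From mathcomp Require Import all_boot all_order all_algebra.
From mathcomp Require Import all_classical all_reals all_analysis.
From mathcomp Require Import lra ring.
Import Order.TTheory GRing.Theory Num.Theory.
Local Open Scope ring_scope.
Set Implicit Arguments.
Unset Strict Implicit.
Unset Printing Implicit Defensive.

(** Convergence. Take as potential the cross entropy of the uniform marginal vector
    relative to the iterate. A step that replaces the two distributions [p], [q] it
    compares by their normalised geometric mean decreases the potential by
    [-2 ln (sum sqrt (p q))], which dominates a quarter of [|p - q|_1^2] as well as a
    quarter of the squared displacement of either component. The potential starts at
    [S] and stays nonnegative, which bounds the number of greedy iterations; in a sweep,
    at most [deg + 1] displacements separate the initial violation of an edge from the
    one met when the edge is processed, and Cauchy-Schwarz gives the cyclic bound.

    Correctness. Every iterate is a Gibbs vector: [log Gamma + eta C] is orthogonal to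
    the directions of the local polytope. At the stopping time [Gamma] therefore
    minimises the entropic objective among the vectors with the same violations, hence
    is nearly as cheap as the optimal vertex, up to [(n + 2 m) ln d / eta] and
    [O(eps)] terms. A nearby point of the local polytope then has weight at least
    [9/10] on the optimal vertex, because all other vertices cost [Delta] more. *)

(** * Affinity, relative entropy and Shannon entropy on a finite set *)

Section Divergences.
Variable R : realType.
Implicit Types (x y : R).

Lemma ln_le_subr1 x : 0 < x -> ln x <= x - 1.
Proof.
move=> x0; rewrite -{1}(addrNK 1 x) addrC; apply: le_ln1Dx; lra.
Qed.

(** Sharper than [x - 1] for large [x]; the spare half pays for the mismatch between [d] and [d ^ 2]
    in the edge terms of [S_quant_le_norm1]. *)
Lemma ln_le_half x : 0 < x -> ln x <= x / 2.
Proof.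
move=> x0; have -> : x = x / 2 * 2 by field.
rewrite lnM ?posrE ?divr_gt0 //.
have := @ln_le_subr1 (x / 2) ltac:(lra); have := @ln_le_subr1 2 ltac:(lra).
lra.
Qed.

Lemma ln_sqrtr x : 0 < x -> ln (Num.sqrt x) = ln x / 2.
Proof.
move=> x0; rewrite -{2}(sqr_sqrtr (ltW x0)) expr2 lnM ?posrE ?sqrtr_gt0 //.
by field.
Qed.

Lemma sum1_ord_gt0 k (f : 'I_k -> R) : \sum_(i < k) f i = 1 -> (0 < k)%N.
Proof. by case: k f => // f; rewrite big_ord0 => /eqP; rewrite eq_sym oner_eq0. Qed.

Lemma ln_divr x y : 0 < x -> 0 < y -> ln (x / y) = ln x - ln y.
Proof. by move=> x0 y0; rewrite ln_div ?posrE. Qed.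

Lemma mul_sqrt_div x y : 0 < x -> 0 < y ->
  x * Num.sqrt (y / x) = Num.sqrt (x * y).
Proof.
move=> x0 y0; have -> : x * y = x ^+ 2 * (y / x) by field; rewrite gt_eqF.
by rewrite [RHS]sqrtrM ?sqr_ge0 // sqrtr_sqr gtr0_norm.
Qed.

Variable T : finType.
Implicit Types a b : T -> R.

(** Bhattacharyya coefficient; also the mass of the unnormalised geometric mean of [a] and [b]. *)
Definition affinity a b := \sum_t Num.sqrt (a t * b t).

Lemma affinity_le1 a b : (forall t, 0 <= a t) -> (forall t, 0 <= b t) ->
  \sum_t a t = 1 -> \sum_t b t = 1 -> affinity a b <= 1.
Proof.
move=> a0 b0 sa sb.
have : affinity a b <= \sum_t (a t + b t) / 2.
  apply: ler_sum => t _; rewrite sqrtrM //.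
  have := sqr_sqrtr (a0 t); have := sqr_sqrtr (b0 t).
  have := sqr_ge0 (Num.sqrt (a t) - Num.sqrt (b t)); nra.
rewrite -mulr_suml big_split /= sa sb; lra.
Qed.

(** With [r], [s] the square roots, [|a - b| = |r - s| (r + s)], and the squares of the two factors
    sum to [2 - 2 A] and [2 + 2 A <= 4], where [A] is the affinity; Cauchy-Schwarz concludes. *)
Lemma affinity_l1 a b : (forall t, 0 <= a t) -> (forall t, 0 <= b t) ->
  \sum_t a t = 1 -> \sum_t b t = 1 ->
  (\sum_t `|a t - b t|) ^+ 2 <= 8 * (1 - affinity a b).
Proof.
move=> a0 b0 sa sb; set v := \sum_t _.
have v0 : 0 <= v by apply: sumr_ge0.
have [->|vn0] := eqVneq v 0.
  by have := affinity_le1 a0 b0 sa sb; lra.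
have vp : 0 < v by rewrite lt_def vn0.
(* Cauchy-Schwarz in AM-GM form, weighted by the total [v] itself: after summation the last term is
   at most [v ^+ 2 / 2] and is absorbed on the left. *)
have key t : v * `|a t - b t| <=
    2 * (a t + b t - 2 * Num.sqrt (a t * b t))
    + v ^+ 2 / 8 * (a t + b t + 2 * Num.sqrt (a t * b t)).
  rewrite sqrtrM //.
  have Ha := sqr_sqrtr (a0 t); have Hb := sqr_sqrtr (b0 t).
  have ra := sqrtr_ge0 (a t); have rb := sqrtr_ge0 (b t).
  set r := Num.sqrt (a t) in Ha ra *; set s := Num.sqrt (b t) in Hb rb *.
  have -> : `|a t - b t| = `|r - s| * (r + s).
    by rewrite -Ha -Hb subr_sqr normrM (ger0_norm (addr_ge0 ra rb)).
  have -> : a t + b t - 2 * (r * s) = `|r - s| ^+ 2.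
    by rewrite real_normK ?num_real // -Ha -Hb; ring.
  have -> : a t + b t + 2 * (r * s) = (r + s) ^+ 2 by rewrite -Ha -Hb; ring.
  have := sqr_ge0 (4 * `|r - s| - v * (r + s)); nra.
have {key} : \sum_t v * `|a t - b t| <= \sum_t (2 * (a t + b t - 2 * Num.sqrt (a t * b t))
    + v ^+ 2 / 8 * (a t + b t + 2 * Num.sqrt (a t * b t))).
  exact: ler_sum.
rewrite -mulr_sumr big_split /= -!mulr_sumr sumrB !big_split /= sa sb.
rewrite -mulr_sumr -/(affinity a b) -/v => H.
have := affinity_le1 a0 b0 sa sb.
move: H; nra.
Qed.

Definition KL a b := \sum_t a t * (ln (a t) - ln (b t)).

(** Pinsker's inequality with a weaker constant: [ln u <= u - 1] at [u = sqrt (b / a)] gives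
    [KL >= 2 (1 - A)] with [A] the affinity, and [affinity_l1] applies. *)
Lemma KL_ge_l1 a b : (forall t, 0 < a t) -> (forall t, 0 < b t) ->
  \sum_t a t = 1 -> \sum_t b t = 1 ->
  (\sum_t `|a t - b t|) ^+ 2 <= 4 * KL a b.
Proof.
move=> a0 b0 sa sb.
apply: le_trans (affinity_l1 (fun t => ltW (a0 t)) (fun t => ltW (b0 t)) sa sb) _.
suff : 2 * \sum_t (a t - Num.sqrt (a t * b t)) <= KL a b.
  rewrite sumrB sa -/(affinity a b); lra.
rewrite mulr_sumr; apply: ler_sum => t _.
have q0 : 0 < b t / a t by rewrite divr_gt0.
have := @ln_le_subr1 (Num.sqrt (b t / a t)).
rewrite sqrtr_gt0 ln_sqrtr // ln_divr // => /(_ q0) H.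
rewrite -mul_sqrt_div //.
have := a0 t; nra.
Qed.

Lemma KL_ge0 a b : (forall t, 0 < a t) -> (forall t, 0 < b t) ->
  \sum_t a t = 1 -> \sum_t b t = 1 -> 0 <= KL a b.
Proof.
move=> a0 b0 sa sb; have := KL_ge_l1 a0 b0 sa sb.
have := sqr_ge0 (\sum_t `|a t - b t|); lra.
Qed.

Lemma entropy_le a : (forall t, 0 < a t) -> \sum_t a t = 1 ->
  - \sum_t a t * ln (a t) <= ln (#|T|%:R).
Proof.
move=> a0 sa.
have T0 : (0 < #|T|)%N.
  rewrite lt0n; apply/eqP => T0; move: sa.
  rewrite big_pred0; first by move/eqP; rewrite eq_sym oner_eq0.
  by move=> t; have := card0_eq T0 t; rewrite inE.
have Tr : 0 < #|T|%:R :> R by rewrite ltr0n.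
have := @KL_ge0 a (fun=> #|T|%:R^-1) a0.
rewrite invr_gt0 Tr sumr_const -[_ *+ _]mulr_natr mulVf ?gt_eqF //.
move=> /(_ (fun=> isT) sa erefl); rewrite /KL.
under eq_bigr do rewrite lnV ?posrE // opprK mulrDr.
rewrite big_split /= -mulr_suml sa; lra.
Qed.

End Divergences.

(** * Linear combinations and entropy of marginal vectors *)

Section Marginals.
Variables (R : realType) (n d m : nat).
Implicit Types (G Z C : marg R n d m).

Lemma marg_ext G Z : (forall i x, mv G i x = mv Z i x) ->
  (forall e x y, me G e x y = me Z e x y) -> G = Z.
Proof.
case: G Z => [gv ge] [zv ze] /= hv he; congr Marg.
  by apply/funext => i; apply/funext => x.
by apply/funext => e; apply/funext => x; apply/funext => y.
Qed.

Definition positive G :=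
  (forall i x, 0 < mv G i x) /\ (forall e x y, 0 < me G e x y).
Definition normalized G :=
  (forall i, \sum_(x < d) mv G i x = 1) /\
  (forall e, \sum_(x < d) \sum_(y < d) me G e x y = 1).

Definition logm G : marg R n d m :=
  Marg (fun i x => ln (mv G i x)) (fun e x y => ln (me G e x y)).

Definition comb (a : R) G (b : R) Z : marg R n d m :=
  Marg (fun i x => a * mv G i x + b * mv Z i x)
       (fun e x y => a * me G e x y + b * me Z e x y).

Lemma inner_comb C a G b Z :
  inner C (comb a G b Z) = a * inner C G + b * inner C Z.
Proof.
rewrite /inner !mulrDr addrACA !mulr_sumr -!big_split /=.
congr (_ + _); apply: eq_bigr => i _; rewrite !mulr_sumr -big_split /=;
  apply: eq_bigr => x _; first ring.
by rewrite !mulr_sumr -big_split /=; apply: eq_bigr => y _; ring.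
Qed.

Lemma rowsum_comb a G b Z e x :
  rowsum (comb a G b Z) e x = a * rowsum G e x + b * rowsum Z e x.
Proof. by rewrite /rowsum big_split /= !mulr_sumr. Qed.

Lemma colsum_comb a G b Z e x :
  colsum (comb a G b Z) e x = a * colsum G e x + b * colsum Z e x.
Proof. by rewrite /colsum big_split /= !mulr_sumr. Qed.

Lemma entry_le1 G : positive G -> normalized G ->
  (forall i x, mv G i x <= 1) /\ (forall e x y, me G e x y <= 1).
Proof.
move=> [pv pe] [nv ne]; split=> [i x|e x y].
  by rewrite -(nv i) (bigD1 x) //= lerDl sumr_ge0 // => *; apply: ltW.
rewrite -(ne e) (bigD1 x) //= (bigD1 y) //= -addrA lerDl.
by rewrite addr_ge0 ?sumr_ge0 // => *; rewrite ?sumr_ge0 // => *; apply: ltW.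
Qed.

Lemma inner_logm_le0 G Z : positive G -> normalized G ->
  (forall i x, 0 <= mv Z i x) -> (forall e x y, 0 <= me Z e x y) ->
  inner (logm G) Z <= 0.
Proof.
move=> pG nG zv ze; have [lv le] := entry_le1 pG nG.
rewrite -oppr_ge0 opprD addr_ge0 // oppr_ge0; apply: sumr_le0 => i _;
  apply: sumr_le0 => x _; first by rewrite mulr_le0_ge0 ?ln_le0.
by apply: sumr_le0 => y _; rewrite mulr_le0_ge0 ?ln_le0.
Qed.

(** A vertex component is a distribution on [d] points and an edge component one on [d ^ 2] points,
    whence the weight [n + 2 m]. *)
Lemma marg_entropy_le G : positive G -> normalized G ->
  - inner (logm G) G <= (n%:R + 2 * m%:R) * ln d%:R.
Proof.
move=> [pv pe] [nv ne]; rewrite /inner opprD mulrDl; apply: lerD.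
  rewrite -sumrN; apply: le_trans (_ : \sum_(i < n) ln d%:R <= _); last first.
    by rewrite sumr_const card_ord mulr_natl.
  apply: ler_sum => i _; have := @entropy_le R _ (mv G i) (pv i) (nv i).
  rewrite card_ord; apply: le_trans; rewrite lerN2.
  by apply: ler_sum => x _; rewrite mulrC.
rewrite -sumrN; apply: le_trans (_ : \sum_(e < m) 2 * ln d%:R <= _); last first.
  by rewrite sumr_const card_ord -[_ *+ _]mulr_natl mulrA [m%:R * 2]mulrC.
apply: ler_sum => e _.
have := @entropy_le R _ (fun z : 'I_d * 'I_d => me G e z.1 z.2) (fun z => pe e z.1 z.2).
rewrite -(pair_bigA _ (fun x y => me G e x y)) /= ne => /(_ erefl).
rewrite -(pair_bigA _ (fun x y => me G e x y * ln (me G e x y))) /=.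
rewrite card_prod card_ord natrM => H.
have d0 := sum1_ord_gt0 (ne e).
move: H; rewrite lnM ?posrE ?ltr0n // => H.
have -> : 2 * ln d%:R = ln d%:R + ln d%:R :> R by ring.
apply: le_trans H; rewrite lerN2; apply: ler_sum => x _; apply: ler_sum => y _.
by rewrite mulrC.
Qed.

End Marginals.

(** * A single one-sided step: closed form, effect on logarithms, displacement *)

Section Steps.
Variables (R : realType) (n d m : nat) (src dst : 'I_m -> 'I_n).
Implicit Types (G Z C : marg R n d m) (b : bool) (e : 'I_m).

(* The boolean selects the side of an edge: [false] is the source (left, rows),
   [true] the destination (right, columns). *)
Definition endpoint b e := if b then dst e else src e.
Definition state b (x y : 'I_d) := if b then y else x.
Definition edge_marg b G e x := if b then colsum G e x else rowsum G e x.
Definition step b G e := if b then right_step dst G e else left_step src G e.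
Definition viol b G e := \sum_(x < d) `|edge_marg b G e x - mv G (endpoint b e) x|.

Lemma sum_edge_marg b G e (h : 'I_d -> R) :
  \sum_(x < d) \sum_(y < d) me G e x y * h (state b x y)
  = \sum_(z < d) edge_marg b G e z * h z.
Proof.
case: b => /=; first rewrite exchange_big /=;
  by apply: eq_bigr => z _; rewrite mulr_suml.
Qed.

Lemma sum_edge_marg1 b G e :
  \sum_(z < d) edge_marg b G e z = \sum_(x < d) \sum_(y < d) me G e x y.
Proof. by case: b => //=; rewrite exchange_big. Qed.

Lemma edge_marg_gt0 b G e x : positive G -> 0 < edge_marg b G e x.
Proof.
move=> [_ pe]; case: b => /=; rewrite /colsum /rowsum (bigD1 x) //=;
 by rewrite ltr_wpDr // sumr_ge0 // => *; apply: ltW.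
Qed.

Definition step_affinity b G e :=
  affinity (mv G (endpoint b e)) (edge_marg b G e).

Lemma step_mv b G e i x : positive G ->
  mv (step b G e) i x =
  if i == endpoint b e
  then Num.sqrt (mv G i x * edge_marg b G e x) / step_affinity b G e
  else mv G i x.
Proof.
move=> pG; have [pv _] := pG.
have H : forall x, mv G (endpoint b e) x * Num.sqrt (edge_marg b G e x / mv G (endpoint b e) x)
   = Num.sqrt (mv G (endpoint b e) x * edge_marg b G e x).
  by move=> z; rewrite mul_sqrt_div ?edge_marg_gt0.
by case: b H => /= H; case: eqVneq => [->|//]; rewrite eqxx H;
  congr (_ / _); apply: eq_bigr.
Qed.

(** Summing first over the state of the other endpoint shows that consistency leaves the edge
    component with the same mass as the vertex component, namely the affinity. *)
Lemma step_me b G e f x y : positive G ->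
  me (step b G e) f x y =
  if f == e then
    me G e x y * Num.sqrt (mv G (endpoint b e) (state b x y) /
                           edge_marg b G e (state b x y)) / step_affinity b G e
  else me G f x y.
Proof.
move=> pG; have [pv _] := pG.
have H : step_affinity b G e = \sum_(x < d) \sum_(y < d) me G e x y *
   Num.sqrt (mv G (endpoint b e) (state b x y) / edge_marg b G e (state b x y)).
  rewrite (sum_edge_marg b G e (fun z => Num.sqrt (mv G (endpoint b e) z / edge_marg b G e z))).
  by apply: eq_bigr => z _; rewrite mul_sqrt_div ?edge_marg_gt0 // mulrC.
by rewrite H; case: b {H} => /=; case: (eqVneq f e) => [_|//]; rewrite eqxx.
Qed.

(** Guarded by a vertex: a feasible marginal vector forces a state to exist only when there is a
    vertex to carry it. *)
Hypothesis d0 : forall i : 'I_n, (0 < d)%N.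

Lemma step_affinity_gt0 b G e : positive G -> 0 < step_affinity b G e.
Proof.
move=> pG; rewrite /step_affinity /affinity (bigD1 (Ordinal (d0 (src e)))) //=.
rewrite ltr_wpDr ?sumr_ge0 //.
by rewrite sqrtr_gt0 mulr_gt0 ?edge_marg_gt0 //; case: pG.
Qed.

Lemma step_positive b G e : positive G -> positive (step b G e).
Proof.
move=> pG; have [pv pe] := pG; split=> [i x|f x y].
  rewrite step_mv //; case: ifP => // _.
  by rewrite divr_gt0 ?step_affinity_gt0 // sqrtr_gt0 mulr_gt0 ?edge_marg_gt0.
rewrite step_me //; case: ifP => // _.
by rewrite divr_gt0 ?step_affinity_gt0 ?mulr_gt0 // sqrtr_gt0 divr_gt0 ?edge_marg_gt0.
Qed.

Lemma step_edge_marg b G e x : positive G ->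
  edge_marg b (step b G e) e x = mv (step b G e) (endpoint b e) x.
Proof.
move=> pG; have [pv _] := pG; rewrite step_mv // eqxx.
rewrite -(mulrC (edge_marg _ _ _ _)) -mul_sqrt_div ?edge_marg_gt0 //.
case: b => /=; rewrite /colsum /rowsum -mulrA mulr_suml; apply: eq_bigr => z _.
  by rewrite (step_me true) // eqxx -mulrA.
by rewrite (step_me false) // eqxx -mulrA.
Qed.

Lemma step_normalized b G e : positive G -> normalized G -> normalized (step b G e).
Proof.
move=> pG [nv ne].
have nv' : forall i, \sum_x mv (step b G e) i x = 1.
  move=> i; under eq_bigr do rewrite step_mv //.
  case: eqVneq => [->|//]; rewrite -mulr_suml mulfV //.
  by rewrite gt_eqF ?step_affinity_gt0.
split=> // f; have [->|fe] := eqVneq f e.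
  rewrite -(sum_edge_marg1 b) -(nv' (endpoint b e)).
  by apply: eq_bigr => x _; rewrite step_edge_marg.
rewrite -(ne f); apply: eq_bigr => x _; apply: eq_bigr => y _.
by rewrite step_me // (negbTE fe).
Qed.

Definition gain b G e : R := - (2 * ln (step_affinity b G e)).

(** The logarithm of the vertex component changes by [- h - L] and that of the edge component by
    [h - L], where [h] is half the log ratio of the two distributions and [L] the log of their
    affinity. Against a [Z] consistent on this side the [h] terms cancel. Used with [Z] uniform for
    the potential, a null direction for the Gibbs property, and the new iterate for the
    divergences. *)
Lemma inner_logm_step b G e Z : positive G ->
  (forall x, edge_marg b Z e x = mv Z (endpoint b e) x) ->
  inner (logm (step b G e)) Z
  = inner (logm G) Z + gain b G e * \sum_(x < d) mv Z (endpoint b e) x.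
Proof.
move=> pG cZ; have [pv pe] := pG.
have s0 := step_affinity_gt0 b e pG.
pose h x := (ln (mv G (endpoint b e) x) - ln (edge_marg b G e x)) / 2.
set L := ln (step_affinity b G e).
apply/eqP; rewrite addrC -subr_eq; apply/eqP.
rewrite /inner opprD addrACA -!sumrB.
rewrite (bigD1 (endpoint b e)) //= [X in _ + X + _]big1 => [|i ie]; last first.
  by rewrite -sumrB big1 // => x _; rewrite step_mv // (negbTE ie) subrr.
rewrite [X in _ + X](bigD1 e) //= [X in _ + (_ + X)]big1 => [|f fe]; last first.
  rewrite -sumrB big1 // => x _; rewrite -sumrB big1 // => y _.
  by rewrite step_me // (negbTE fe) subrr.
rewrite !addr0 -!sumrB.
have -> : \sum_(x < d) (ln (mv (step b G e) (endpoint b e) x) * mv Z (endpoint b e) x -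
      ln (mv G (endpoint b e) x) * mv Z (endpoint b e) x)
    = \sum_(x < d) mv Z (endpoint b e) x * (- h x - L).
  apply: eq_bigr => x _; rewrite step_mv // eqxx ln_divr ?sqrtr_gt0 ?mulr_gt0 ?edge_marg_gt0 //.
  rewrite ln_sqrtr ?mulr_gt0 ?edge_marg_gt0 // lnM ?posrE ?edge_marg_gt0 //.
  by rewrite /h -/L; field.
have -> : \sum_(x < d) (\sum_(y < d) ln (me (step b G e) e x y) * me Z e x y -
      \sum_(y < d) ln (me G e x y) * me Z e x y)
    = \sum_(x < d) \sum_(y < d) me Z e x y * (h (state b x y) - L).
  apply: eq_bigr => x _; rewrite -sumrB; apply: eq_bigr => y _.
  rewrite step_me // eqxx ln_divr ?mulr_gt0 ?sqrtr_gt0 ?divr_gt0 ?edge_marg_gt0 //.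
  rewrite lnM ?posrE ?sqrtr_gt0 ?divr_gt0 ?edge_marg_gt0 //.
  rewrite ln_sqrtr ?divr_gt0 ?edge_marg_gt0 // ln_divr ?edge_marg_gt0 //.
  by rewrite -/L /h; ring.
rewrite (sum_edge_marg b Z e (fun z => h z - L)) -big_split /= mulr_sumr.
by apply: eq_bigr => x _; rewrite cZ /gain -/L; ring.
Qed.

Lemma viol_le_gain b G e : positive G -> normalized G ->
  viol b G e ^+ 2 <= 4 * gain b G e.
Proof.
move=> pG nG; have [pv pe] := pG; have [nv ne] := nG.
have := @affinity_l1 R _ (mv G (endpoint b e)) (edge_marg b G e)
  (fun x => ltW (pv _ x)) (fun x => ltW (edge_marg_gt0 b e x pG)) (nv _).
rewrite sum_edge_marg1 ne => /(_ erefl) H.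
have := ln_le_subr1 (step_affinity_gt0 b e pG); rewrite /gain.
rewrite /viol; under eq_bigr do rewrite distrC.
by move: H; rewrite -/(step_affinity b G e); lra.
Qed.

Lemma gain_ge0 b G e : positive G -> normalized G -> 0 <= gain b G e.
Proof.
move=> pG nG; have := viol_le_gain b e pG nG.
have := sqr_ge0 (viol b G e); lra.
Qed.

(** Pythagorean identity of a Bregman projection: the two components changed by the step are
    consistent on its side afterwards, so [inner_logm_step] applies to them. *)
Lemma KL_step b G e : positive G -> normalized G ->
  KL (mv (step b G e) (endpoint b e)) (mv G (endpoint b e))
  + KL (fun z : 'I_d * 'I_d => me (step b G e) e z.1 z.2)
       (fun z : 'I_d * 'I_d => me G e z.1 z.2) = gain b G e.
Proof.
move=> pG nG.
have [nv' _] := step_normalized b e pG nG.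
have := @inner_logm_step b G e
  (Marg (fun i x => if i == endpoint b e then mv (step b G e) i x else 0)
        (fun f x y => if f == e then me (step b G e) f x y else 0)) pG.
rewrite /= eqxx nv' mulr1.
have E : forall x, edge_marg b (Marg (fun i x => if i == endpoint b e then mv (step b G e) i x else 0)
        (fun f x y => if f == e then me (step b G e) f x y else 0)) e x =
    mv (step b G e) (endpoint b e) x.
  move=> x; rewrite -step_edge_marg // /edge_marg /colsum /rowsum /= eqxx.
  by case: (b).
move=> /(_ E) {E} H.
apply: (@addrI _ (inner (logm G)
  (Marg (fun i x => if i == endpoint b e then mv (step b G e) i x else 0)
        (fun f x y => if f == e then me (step b G e) f x y else 0)))).
rewrite -H {H} /inner /=.
have Hv (L : 'I_n -> 'I_d -> R) : \sum_(i < n) \sum_(x < d)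
     L i x * (if i == endpoint b e then mv (step b G e) i x else 0)
   = \sum_(x < d) L (endpoint b e) x * mv (step b G e) (endpoint b e) x.
  rewrite (bigD1 (endpoint b e)) //= [X in _ + X]big1 => [|i /negbTE ie].
    by rewrite addr0; apply: eq_bigr => x _; rewrite eqxx.
  by rewrite big1 // => x _; rewrite ie mulr0.
have He (L : 'I_m -> 'I_d -> 'I_d -> R) : \sum_(f < m) \sum_(x < d) \sum_(y < d)
     L f x y * (if f == e then me (step b G e) f x y else 0)
   = \sum_(x < d) \sum_(y < d) L e x y * me (step b G e) e x y.
  rewrite (bigD1 e) //= [X in _ + X]big1 => [|f /negbTE fe].
    by rewrite addr0; apply: eq_bigr => x _; apply: eq_bigr => y _; rewrite eqxx.
  by rewrite big1 // => x _; rewrite big1 // => y _; rewrite fe mulr0.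
rewrite (Hv (fun i x => ln (mv G i x))) (Hv (fun i x => ln (mv (step b G e) i x))).
rewrite (He (fun i x y => ln (me G i x y))) (He (fun i x y => ln (me (step b G e) i x y))).
rewrite /KL -(pair_bigA _ (fun x y => me (step b G e) e x y * (ln (me (step b G e) e x y) - ln (me G e x y)))) /=.
rewrite addrACA; congr (_ + _); rewrite -big_split /=; apply: eq_bigr => x _; first ring.
by rewrite -big_split /=; apply: eq_bigr => y _; ring.
Qed.

(** Both divergences in [KL_step] are nonnegative, so either one is bounded by the gain; [KL_ge_l1]
    turns it into a displacement. *)
Lemma step_mv_move b G e : positive G -> normalized G ->
  (\sum_x `|mv G (endpoint b e) x - mv (step b G e) (endpoint b e) x|) ^+ 2
  <= 4 * gain b G e.
Proof.
move=> pG nG; have [pv pe] := pG; have [nv ne] := nG.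
have [pv' pe'] := step_positive b e pG.
have [nv' ne'] := step_normalized b e pG nG.
rewrite -KL_step // mulrDr.
under eq_bigr do rewrite distrC.
apply: ler_wpDr; last exact: KL_ge_l1.
rewrite mulr_ge0 // KL_ge0 //.
  by rewrite -(pair_bigA _ (fun x y => me (step b G e) e x y)).
by rewrite -(pair_bigA _ (fun x y => me G e x y)).
Qed.

Lemma step_me_move b G e : positive G -> normalized G ->
  (\sum_x \sum_y `|me G e x y - me (step b G e) e x y|) ^+ 2
  <= 4 * gain b G e.
Proof.
move=> pG nG; have [pv pe] := pG; have [nv ne] := nG.
have [pv' pe'] := step_positive b e pG.
have [nv' ne'] := step_normalized b e pG nG.
rewrite -KL_step // mulrDr; apply: ler_wpDl.
  by rewrite mulr_ge0 // KL_ge0.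
rewrite (pair_bigA _ (fun x y => `|me G e x y - me (step b G e) e x y|)) /=.
under eq_bigr do rewrite distrC.
apply: (KL_ge_l1 (a := fun z : 'I_d * 'I_d => me (step b G e) e z.1 z.2)
                 (b := fun z => me G e z.1 z.2)) => //.
  by rewrite -(pair_bigA _ (fun x y => me (step b G e) e x y)).
by rewrite -(pair_bigA _ (fun x y => me G e x y)).
Qed.

End Steps.

(** * The potential, the Gibbs invariant and descent along a sweep *)

Section Potential.
Variables (R : realType) (n d m : nat) (src dst : 'I_m -> 'I_n).
Variables (C : marg R n d m) (eta : R).
Hypothesis d0 : forall i : 'I_n, (0 < d)%N.
Implicit Types (G Z D : marg R n d m) (b : bool) (e : 'I_m).

Local Notation step := (step src dst).
Local Notation endpoint := (endpoint src dst).
Local Notation viol := (viol src dst).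
Local Notation gain := (gain src dst).

Definition uniform : marg R n d m :=
  Marg (fun _ _ => d%:R^-1) (fun _ _ _ => d%:R^-1 * d%:R^-1).

Lemma natd_neq0 (i : 'I_n) : d%:R != 0 :> R.
Proof. by rewrite pnatr_eq0 -lt0n (d0 i). Qed.

Lemma uniform_sum i : \sum_(x < d) mv uniform i x = 1.
Proof. by rewrite sumr_const card_ord -[_ *+ _]mulr_natr mulVf ?(natd_neq0 i). Qed.

Lemma uniform_marg b e x : edge_marg b uniform e x = mv uniform (endpoint b e) x.
Proof.
by case: b; rewrite /= /colsum /rowsum sumr_const card_ord -[_ *+ _]mulr_natr
   -mulrA mulVf ?mulr1 ?(natd_neq0 (src e)).
Qed.

Definition pot G : R := - inner (logm G) uniform.

Lemma pot_ge0 G : positive G -> normalized G -> 0 <= pot G.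
Proof.
move=> pG nG; rewrite oppr_ge0; apply: inner_logm_le0 => //=.
Qed.

Lemma pot_step b G e : positive G -> pot (step b G e) = pot G - gain b G e.
Proof.
move=> pG; rewrite /pot (inner_logm_step d0) // => [|x]; last exact: uniform_marg.
by rewrite uniform_sum mulr1 opprD.
Qed.

Definition null D :=
  (forall i, \sum_(x < d) mv D i x = 0) /\
  (forall b e x, edge_marg b D e x = mv D (endpoint b e) x).

(** First-order optimality for the entropic objective along null directions; the right-hand sides of
    the constraints are left free. *)
Definition gibbs G := forall D, null D -> inner (logm G) D = - (eta * inner C D).

Definition emp_inv G := [/\ positive G, normalized G & gibbs G].

Lemma emp_inv_step b G e : emp_inv G -> emp_inv (step b G e).
Proof.
move=> [pG nG gG]; split; [exact: step_positive|exact: step_normalized|].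
move=> D [Ds Dm]; rewrite (inner_logm_step d0) // Ds mulr0 addr0.
exact: gG.
Qed.

Let zv i : R := \sum_(x < d) expR (- (eta * mv C i x)).
Let ze e : R := \sum_(x < d) \sum_(y < d) expR (- (eta * me C e x y)).

Let zv_gt0 i : 0 < zv i.
Proof.
by rewrite /zv (bigD1 (Ordinal (d0 i))) //= ltr_wpDr ?expR_gt0 ?sumr_ge0.
Qed.

Let ze_gt0 e : 0 < ze e.
Proof.
pose o := Ordinal (d0 (src e)).
rewrite /ze (bigD1 o) //= (bigD1 o) //= -addrA ltr_wpDr ?expR_gt0 //.
by rewrite addr_ge0 ?sumr_ge0 // => *; rewrite sumr_ge0.
Qed.

Lemma inner_logm_init Z : inner (logm (emp_init C eta)) Z =
  - (eta * inner C Z)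
  - \sum_(i < n) ln (zv i) * \sum_(x < d) mv Z i x
  - \sum_(e < m) ln (ze e) * \sum_(x < d) \sum_(y < d) me Z e x y.
Proof.
rewrite /inner mulrDr opprD -[RHS]addrA [RHS]addrACA.
congr (_ + _); rewrite mulr_sumr -sumrN -sumrB; apply: eq_bigr => i _.
  rewrite !mulr_sumr -sumrN -sumrB; apply: eq_bigr => x _ /=.
  by rewrite ln_divr ?expR_gt0 ?zv_gt0 // expRK -/(zv i); ring.
rewrite !mulr_sumr -sumrN -sumrB; apply: eq_bigr => x _ /=.
rewrite !mulr_sumr -sumrN -sumrB; apply: eq_bigr => y _ /=.
by rewrite ln_divr ?expR_gt0 ?ze_gt0 // expRK -/(ze i); ring.
Qed.

Lemma emp_inv_init : emp_inv (emp_init C eta).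
Proof.
split.
- by split=> *; rewrite /= divr_gt0 ?expR_gt0 ?zv_gt0 ?ze_gt0.
- split=> [i|e] /=; first by rewrite -mulr_suml mulfV // gt_eqF ?zv_gt0.
  under eq_bigr do rewrite -mulr_suml.
  by rewrite -mulr_suml mulfV // gt_eqF ?ze_gt0.
- move=> D [Ds Dm]; rewrite inner_logm_init big1 => [|i _]; last by rewrite Ds mulr0.
  rewrite big1 ?subr0 // => e _; rewrite -(sum_edge_marg1 false).
  under eq_bigr do rewrite Dm.
  by rewrite Ds mulr0.
Qed.

Lemma pot_init : pot (emp_init C eta) = S_quant C eta.
Proof.
have Ei : \sum_(i < n) ln (zv i) * \sum_(x < d) mv uniform i x = \sum_(i < n) ln (zv i).
  by apply: eq_bigr => i _; rewrite uniform_sum mulr1.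
have Ee : \sum_(e < m) ln (ze e) * \sum_(x < d) \sum_(y < d) me uniform e x y
    = \sum_(e < m) ln (ze e).
  apply: eq_bigr => e _; rewrite -(sum_edge_marg1 false).
  under eq_bigr do rewrite uniform_marg.
  by rewrite uniform_sum mulr1.
have Eu : eta * inner C uniform = \sum_(i < n) \sum_(x < d) eta / d%:R * mv C i x
    + \sum_(e < m) \sum_(x < d) \sum_(y < d) eta / d%:R ^+ 2 * me C e x y.
  rewrite /inner mulrDr !mulr_sumr; congr (_ + _); apply: eq_bigr => i _;
    rewrite mulr_sumr; apply: eq_bigr => x _ /=; first ring.
  by rewrite mulr_sumr; apply: eq_bigr => y _ /=; rewrite expr2 invfM; ring.
by rewrite /pot inner_logm_init Ei Ee Eu /S_quant !big_split /= /zv /ze; ring.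
Qed.

(** Entrywise, after [ln z <= z - 1] at vertices and [ln z <= z / 2] on edges; with [u = 1 / d], an
    edge entry needs [0 <= exp (- c) / 2 + c u (1 - u)]. *)
Lemma S_quant_le_norm1 : S_quant C eta <= norm1_init C eta.
Proof.
rewrite /S_quant /norm1_init addrC; apply: lerD; apply: ler_sum => i _.
  have d1 : 1 <= d%:R :> R by rewrite ler1n (d0 i).
  apply: (@le_trans _ _ (zv i + \sum_(x < d) eta / d%:R * mv C i x)).
    by rewrite lerD2r; have := ln_le_subr1 (zv_gt0 i); rewrite -/(zv i); lra.
  rewrite -big_split /=; apply: ler_sum => x _.
  apply: le_trans (ler_norm _); rewrite addrC lerD2r.
  by rewrite mulrAC.
have d1 : 1 <= d%:R :> R by rewrite ler1n (d0 (src i)).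
apply: (@le_trans _ _ (ze i / 2 + \sum_(x < d) \sum_(y < d) eta / d%:R ^+ 2 * me C i x y)).
  by rewrite lerD2r; apply: ln_le_half; apply: ze_gt0.
rewrite /ze mulr_suml -big_split /=; apply: ler_sum => x _.
rewrite mulr_suml -big_split /=; apply: ler_sum => y _.
apply: le_trans (ler_norm _).
set c := eta * me C i x y.
have -> : eta / d%:R ^+ 2 * me C i x y = c / d%:R * d%:R^-1.
  by rewrite /c; field; rewrite (natd_neq0 (src i)).
set u := d%:R^-1.
have u0 : 0 < u by rewrite invr_gt0 (lt_le_trans _ d1).
have u1 : u <= 1 by rewrite invf_le1 // (lt_le_trans _ d1).
have := expR_ge1Dx (- c); have := expR_gt0 (- c).
set E := expR (- c) => E0 E1.
(* For negative [c], [u (1 - u) <= 1 / 4] and [exp (- c) >= 1 - c] suffice. *)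
have [c0|c0] := leP 0 c; first last.
  have q1 : u * (1 - u) <= 1 / 4 by have := sqr_ge0 (u - 1 / 2); nra.
  have : - c * (u * (1 - u)) <= - c * (1 / 4) by apply: ler_wpM2l => //; lra.
  nra.
have : 0 <= c * u * (1 - u).
  by apply: mulr_ge0; [apply: mulr_ge0 => //; apply: ltW | rewrite subr_ge0].
nra.
Qed.

Lemma S0E : S0 C eta = pot (emp_init C eta).
Proof. by rewrite pot_init /S0; apply/min_idPr/S_quant_le_norm1. Qed.

Lemma viol_triangle b G G' e :
  viol b G e <= viol b G' e
    + \sum_(x < d) `|edge_marg b G e x - edge_marg b G' e x|
    + \sum_(x < d) `|mv G (endpoint b e) x - mv G' (endpoint b e) x|.
Proof.
rewrite /viol -!big_split /=; apply: ler_sum => x _.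
set p := edge_marg b G e x; set p' := edge_marg b G' e x.
set q := mv _ _ _; set q' := mv _ _ _.
have -> : p - q = (p' - q') + (p - p') - (q - q') by ring.
by apply: le_trans (ler_normB _ _) _; rewrite lerD2r ler_normD.
Qed.

(** Cauchy-Schwarz [(a + c)^2 <= (k + 1) (a^2 + c^2 / k)], freed from the division so that [k = 0]
    is allowed; one more displacement raises the factor from [k] to [k + 1]. *)
Lemma sqr_le_cauchy (k a c g h v : R) : 0 <= k -> 0 <= a -> 0 <= c -> 0 <= v ->
  v <= a + c -> a ^+ 2 <= 4 * g -> c ^+ 2 <= 4 * k * h -> 0 <= h ->
  v ^+ 2 <= 4 * (k + 1) * (g + h).
Proof.
move=> k0 a0 c0 v0 vac ag ch h0.
have g0 : 0 <= g by have := sqr_ge0 a; lra.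
have kg0 : 0 <= k * g by rewrite mulr_ge0.
have H : a * c <= 2 * (k * g + h).
  rewrite -(@ler_pXn2r _ 2) ?nnegrE ?mulr_ge0 ?addr_ge0 // exprMn.
  apply: le_trans (ler_pM (sqr_ge0 _) (sqr_ge0 _) ag ch) _.
  have := sqr_ge0 (k * g - h); nra.
have : v ^+ 2 <= (a + c) ^+ 2 by rewrite ler_pXn2r ?nnegrE ?addr_ge0.
nra.
Qed.

Definition sweep_edge G e := step true (step false G e) e.

Lemma cyclic_iterationE G :
  cyclic_iteration src dst G = foldl sweep_edge G (enum 'I_m).
Proof. by []. Qed.

Lemma pot_step_le b G e : emp_inv G -> pot (step b G e) <= pot G.
Proof.
by move=> [pG nG _]; rewrite pot_step // gerBl gain_ge0.
Qed.

Lemma emp_inv_sweep es G : emp_inv G -> emp_inv (foldl sweep_edge G es).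
Proof. by elim: es G => //= f es IH G iG; apply/IH/emp_inv_step/emp_inv_step. Qed.

Lemma pot_sweep_le es G : emp_inv G -> pot (foldl sweep_edge G es) <= pot G.
Proof.
elim: es G => //= f es IH G iG.
have i1 := emp_inv_step false f iG; have i2 := emp_inv_step true f i1.
by apply: le_trans (IH _ i2) (le_trans (pot_step_le _ _ i1) (pot_step_le _ _ iG)).
Qed.

Definition incident i e := (src e == i) || (dst e == i).

Hypothesis sd : forall e, src e != dst e.

(* Between the start of the sweep and the processing of side [b] of [e], only steps
   on edges at [endpoint b e] (and the left step on [e] itself when [b] is the right
   side) move the two distributions compared by [viol b G e]. *)
Lemma viol_sweep b e es G : emp_inv G -> uniq es -> e \in es ->
  viol b G e ^+ 2 <=
  4 * ((count (incident (endpoint b e)) es)%:R + b%:R)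
    * (pot G - pot (foldl sweep_edge G es)).
Proof.
have viol0 b' G' e' : 0 <= viol b' G' e' by apply: sumr_ge0.
elim: es G => // f es IH G iG /= /andP[fes ues]; rewrite inE.
have i1 := emp_inv_step false f iG.
have i2 := emp_inv_step true f i1.
have [pG nG _] := iG; have [pG1 nG1 _] := i1; have [pG2 nG2 _] := i2.
have E1 := pot_step false f pG; have E2 := pot_step true f pG1.
have g1 := gain_ge0 src dst d0 false f pG nG.
have g2 := gain_ge0 src dst d0 true f pG1 nG1.
rewrite -/(sweep_edge G f).
have le_end := pot_sweep_le es i2.
set P := pot (foldl _ _ _) in le_end *.
rewrite -/(sweep_edge G f) in le_end E2 i2 pG2 nG2 *.
case: (eqVneq e f) => [ef _|ef /= ees].
  subst f.
  have -> : incident (endpoint b e) e by rewrite /incident; case: (b); rewrite /= eqxx ?orbT.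
  case: b {IH} => /=.
    (* On the right side of [e], the preceding left step moves only the column marginal, the
       endpoints being distinct; this displacement and the violation then met share the factor 2. *)
    have H := @sqr_le_cauchy 1
      (\sum_(x < d) `|edge_marg true G e x - edge_marg true (step false G e) e x|)
      (viol true (step false G e) e) (gain false G e) (gain true (step false G e) e)
      (viol true G e) ler01.
    apply: le_trans (H _ _ _ _ _ _ _) _ => //; first exact: sumr_ge0.
    - apply: le_trans (viol_triangle true G (step false G e) e) _.
      rewrite [X in _ + X]big1 ?addr0 1?addrC // => x _.
      by rewrite step_mv // /= eq_sym (negbTE (sd e)) subrr normr0.
    - apply: le_trans (step_me_move src dst d0 false e pG nG).
      rewrite ler_pXn2r ?nnegrE ?sumr_ge0 // => [|x _]; last exact: sumr_ge0.
      rewrite exchange_big /=; apply: ler_sum => y _.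
      by rewrite /colsum -sumrB; apply: ler_norm_sum.
    - by rewrite mulr1; apply: viol_le_gain.
    - apply: ler_pM; rewrite ?mulr_ge0 ?addr_ge0 //; last lra.
      by rewrite ler_wpM2l // lerD2r ler1n.
  apply: le_trans (viol_le_gain src dst d0 false e pG nG) _.
  rewrite addr0 -mulrA ler_wpM2l // -[X in X <= _]mul1r.
  apply: ler_pM => //; first by rewrite ler1n.
  lra.
have me_eq b' G' : positive G' -> forall x y, me (step b' G' f) e x y = me G' e x y.
  by move=> p' x y; rewrite step_me // (negbTE ef).
have em_eq b' G' : positive G' -> forall x, edge_marg b (step b' G' f) e x = edge_marg b G' e x.
  by move=> p' x; case: (b) => /=; apply: eq_bigr => y _; rewrite me_eq.
have IH' := IH _ i2 ues ees; rewrite -/P in IH'.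
have k0 : 0 <= (count (incident (endpoint b e)) es)%:R + b%:R :> R by rewrite addr_ge0.
have em2 x : edge_marg b (sweep_edge G f) e x = edge_marg b G e x by rewrite !em_eq.
have [inc|ninc] := boolP (incident (endpoint b e) f); last first.
  move: ninc; rewrite negb_or => /andP[n1 n2].
  have -> : viol b G e = viol b (sweep_edge G f) e.
    apply: eq_bigr => x _; rewrite em2 /sweep_edge step_mv // eq_sym (negbTE n2).
    by rewrite step_mv // eq_sym (negbTE n1).
  apply: le_trans IH' _; rewrite add0n ler_wpM2l ?mulr_ge0 //; lra.
set i := endpoint b e in inc k0 IH' *.
(* Of the two half-steps on [f], only the one at the endpoint equal to [i] moves the component at
   [i], since [f] has distinct endpoints; its gain is the witness. *)
have [g [ge0 gle Hg]] : exists g, [/\ 0 <= g, g <= pot G - pot (sweep_edge G f) &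
    (\sum_(x < d) `|mv G i x - mv (sweep_edge G f) i x|) ^+ 2 <= 4 * g].
  case/orP: inc => /eqP fi.
    exists (gain false G f); split=> //; first lra.
    apply: le_trans (step_mv_move src dst d0 false f pG nG).
    rewrite [endpoint _ _]fi le_eqVlt; apply/orP; left; apply/eqP; congr (_ ^+ 2).
    apply: eq_bigr => x _; rewrite /sweep_edge (step_mv _ _ true) // -fi.
    by rewrite (negbTE (sd f)).
  exists (gain true (step false G f) f); split=> //; first lra.
  apply: le_trans (step_mv_move src dst d0 true f pG1 nG1).
  rewrite [endpoint _ _]fi le_eqVlt; apply/orP; left; apply/eqP; congr (_ ^+ 2).
  apply: eq_bigr => x _; rewrite [in RHS](step_mv _ _ false) // -fi.
  by rewrite eq_sym (negbTE (sd f)).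
have H := @sqr_le_cauchy _ _ _ g (pot (sweep_edge G f) - P) (viol b G e) k0
  (_ : 0 <= \sum_(x < d) `|mv G i x - mv (sweep_edge G f) i x|)
  (viol0 b (sweep_edge G f) e).
apply: le_trans (H _ _ _ Hg IH' _) _ => //; first exact: sumr_ge0; last 2 first.
- lra.
- have -> : (true + count (incident i) es)%:R + b%:R
      = (count (incident i) es)%:R + b%:R + 1 :> R by rewrite natrD /=; ring.
  rewrite ler_wpM2l ?mulr_ge0 ?addr_ge0 //; lra.
apply: le_trans (viol_triangle b G (sweep_edge G f) e) _.
rewrite [X in _ + X + _]big1 ?addr0 1?addrC // => x _.
by rewrite em2 subrr normr0.
Qed.

Lemma count_incident i : count (incident i) (enum 'I_m) = deg src dst i.
Proof.
rewrite -size_filter enumT /deg cardE /enum_mem.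
congr size; apply: eq_filter => e.
by apply/idP/idP; rewrite in_setE.
Qed.

(** The edges met at the endpoint number at most its degree; the extra 1 accounts for the left step
    that precedes the right step on the same edge. *)
Lemma viol_cyclic b G e : emp_inv G ->
  viol b G e ^+ 2 <=
  4 * ((maxdeg src dst)%:R + 1) * (pot G - pot (cyclic_iteration src dst G)).
Proof.
move=> iG; have := @viol_sweep b e (enum 'I_m) G iG (enum_uniq _).
rewrite mem_enum => /(_ isT) H; apply: le_trans H _.
rewrite -cyclic_iterationE ler_wpM2r ?subr_ge0 ?pot_sweep_le //.
rewrite ler_wpM2l // lerD ?ler_nat //; last by case: (b).
by rewrite count_incident /maxdeg leq_bigmax.
Qed.

End Potential.

(** Running forever would exceed the budget [S] by the Archimedean property, so a least stopping
    index exists. *)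
Lemma first_stop (R : realType) (stop : nat -> Prop) (delta S : R) :
  0 < delta ->
  (forall t, (forall s, (s < t)%N -> ~ stop s) -> t%:R * delta <= S) ->
  exists t, [/\ stop t, forall s, (s < t)%N -> ~ stop s & t%:R * delta <= S].
Proof.
move=> dl H.
have ex : exists t, `[< stop t >].
  apply/not_existsP => ns.
  have ns' s : ~ stop s by move=> st; apply: (ns s); apply/asboolP.
  have := H (Num.bound (S / delta)) (fun s _ => ns' s).
  rewrite -ler_pdivlMr // leNgt => /negP; apply.
  apply/archi_boundP/divr_ge0; last exact: ltW.
  by have := H 0%N; rewrite mul0r; apply.
exists (ex_minn ex); case: ex_minnP => t /asboolP st mt.
have nt s : (s < t)%N -> ~ stop s.
  by move=> st' /asboolP ss; have := mt s ss; rewrite leqNgt st'.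
by split => //; apply: H.
Qed.

(** * Geometry of the local polytope: vertices, integral points and the optimality gap *)

Section LocalPolytope.
Variables (R : realType) (n d m : nat) (src dst : 'I_m -> 'I_n).
Implicit Types (A B C D F G V W : marg R n d m).

Local Notation in_L2 := (in_L2 src dst).
Local Notation is_vertex := (is_vertex src dst).
Local Notation endpoint := (endpoint src dst).
Local Notation null := (null src dst).
Local Notation integral := Defs.integral.

Lemma innerC C G : inner C G = inner G C.
Proof.
rewrite /inner; congr (_ + _); apply: eq_bigr => i _; apply: eq_bigr => x _.
  by rewrite mulrC.
by apply: eq_bigr => y _; rewrite mulrC.
Qed.

Lemma edge_marg_comb b (s : R) G (t : R) D e x :
  edge_marg b (comb s G t D) e x = s * edge_marg b G e x + t * edge_marg b D e x.
Proof. by case: b; rewrite /= ?colsum_comb ?rowsum_comb. Qed.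

Lemma in_L2P G : in_L2 G <->
  [/\ forall i x, 0 <= mv G i x, forall e x y, 0 <= me G e x y,
      forall i, \sum_(x < d) mv G i x = 1 &
      forall b e x, edge_marg b G e x = mv G (endpoint b e) x].
Proof.
split=> [[gv [ge [gs [gr gc]]]]|[gv ge gs gm]].
  by split=> // -[] e x /=.
do 4 split=> //; first exact: (gm false).
exact: (gm true).
Qed.

Lemma in_L2_le1 G : in_L2 G ->
  (forall i x, mv G i x <= 1) /\ (forall e x y, me G e x y <= 1).
Proof.
move=> [gv [ge [gs [gr gc]]]].
have v1 i x : mv G i x <= 1 by rewrite -(gs i) (bigD1 x) //= lerDl sumr_ge0.
split=> // e x y; apply: le_trans (v1 (src e) x).
by rewrite -gr /rowsum (bigD1 y) //= lerDl sumr_ge0.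
Qed.

Lemma null_diff A B : in_L2 A -> in_L2 B -> null (comb 1 A (-1) B).
Proof.
move=> /in_L2P[_ _ sA mA] /in_L2P[_ _ sB mB]; split=> [i|b e x].
  by rewrite big_split /= -!mulr_sumr sA sB; ring.
by rewrite edge_marg_comb mA mB.
Qed.

Lemma in_L2_null G s D : in_L2 G -> null D ->
  (forall i x, 0 <= mv (comb 1 G s D) i x) ->
  (forall e x y, 0 <= me (comb 1 G s D) e x y) -> in_L2 (comb 1 G s D).
Proof.
move=> /in_L2P[_ _ sG mG] [sD mD] pv pe; apply/in_L2P; split=> // [i|b e x].
  by rewrite big_split /= -!mulr_sumr sG sD; ring.
by rewrite edge_marg_comb mG mD.
Qed.

Definition coord_index : finType := (('I_n * 'I_d) + ('I_m * ('I_d * 'I_d)))%type.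
Definition coord G (t : coord_index) : R :=
  match t with inl p => mv G p.1 p.2 | inr p => me G p.1 p.2.1 p.2.2 end.

Lemma coord_ext G W : (forall t, coord G t = coord W t) -> G = W.
Proof.
move=> h; apply: marg_ext => [i x|e x y]; first exact: (h (inl (i, x))).
exact: (h (inr (e, (x, y)))).
Qed.

Lemma coord_comb s G t D k : coord (comb s G t D) k = s * coord G k + t * coord D k.
Proof. by case: k. Qed.

Lemma coord_ge0P G : (forall t, 0 <= coord G t) <->
  (forall i x, 0 <= mv G i x) /\ (forall e x y, 0 <= me G e x y).
Proof.
split=> [h|[hv he] [p|p]] //=; split=> [i x|e x y]; first exact: (h (inl (i, x))).
exact: (h (inr (e, (x, y)))).
Qed.

Lemma in_L2_coord G : in_L2 G -> forall t, 0 <= coord G t <= 1.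
Proof.
move=> hG; have [v1 e1] := in_L2_le1 hG; case/in_L2P: hG => gv ge _ _.
by case=> [p|p] /=; rewrite ?gv ?ge ?v1 ?e1.
Qed.

(** The polytope has no recession direction, so every nonzero null direction has a negative
    coordinate and eventually leaves it. *)
Lemma null_ge0_eq0 D : null D -> (forall t, 0 <= coord D t) -> forall t, coord D t = 0.
Proof.
move=> [sD mD] /coord_ge0P[pv pe].
have zv i x : mv D i x = 0 by apply: (psumr_eq0P _ (sD i)) => // y _; apply: pv.
case=> [[i x]|[e [x y]]] /=; first exact: zv.
have /= := mD false e x; rewrite zv => h.
by apply: (psumr_eq0P _ h) => // z _; apply: pe.
Qed.

Definition supp G : {ffun coord_index -> bool} := [ffun t => coord G t != 0].

(* Moving along a feasible direction on which the functional does not increase, until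
   a coordinate vanishes, shrinks the support. *)
Lemma vertex_below F G : in_L2 G -> exists2 W, is_vertex W & inner F W <= inner F G.
Proof.
have [k] := ubnP #|[pred t | coord G t != 0]|; elim: k G => // k IH G sk hG.
have [vG|nvG] := pselect (is_vertex G); first by exists G.
(* A non-extreme point is a proper mixture of two distinct [A] and [B]; their difference, oriented
   so that [F] does not increase, vanishes wherever [G] does. *)
have [D [nD Dn0 FD DG]] : exists D, [/\ null D, ~ (forall t, coord D t = 0),
    inner F D <= 0 & forall t, coord G t = 0 -> coord D t = 0].
  have [A [B [t [hA [hB [/andP[t0 t1] [GAB AB]]]]]]] : exists A B t,
      in_L2 A /\ in_L2 B /\ 0 < t < 1 /\ G = mix t A B /\ A <> B.
    apply: contrapT => h; apply: nvG; split=> // A B t hA hB t01 GAB.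
    by apply: contrapT => AB; apply: h; exists A, B, t.
  have z s : coord G s = 0 -> coord A s = 0 /\ coord B s = 0.
    have -> : coord G s = t * coord A s + (1 - t) * coord B s by rewrite GAB; case: s.
    have /andP[a0 _] := in_L2_coord hA s; have /andP[b0 _] := in_L2_coord hB s.
    by move=> h; split; nra.
  have ne A' B' : A' <> B' -> ~ (forall s, coord (comb 1 A' (-1) B') s = 0).
    move=> AB' h; apply: AB'; apply: coord_ext => s.
    have := h s; rewrite coord_comb; lra.
  have [le|gt] := leP (inner F A) (inner F B).
    exists (comb 1 A (-1) B); split; [exact: null_diff|exact: ne| |].
      rewrite inner_comb; lra.
    by move=> s /z[zA zB]; rewrite coord_comb zA zB; ring.
  exists (comb 1 B (-1) A); split; [exact: null_diff|apply: ne|rewrite inner_comb; lra|].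
    by move=> BA; apply: AB.
  by move=> s /z[zA zB]; rewrite coord_comb zA zB; ring.
have G0 t : 0 <= coord G t by case/andP: (in_L2_coord hG t).
have [t0 Dt0] : exists t, coord D t < 0.
  apply: contrapT => h; apply: Dn0; apply: null_ge0_eq0 => // t.
  by rewrite leNgt; apply/negP => lt; apply: h; exists t.
(* Ratio test: [s] is the longest feasible step, at which the coordinate [t1] reaches zero. *)
case: (arg_minP (fun t => coord G t / - coord D t) (Dt0 : [pred t | coord D t < 0] t0)).
move=> t1 /= Dt1 mt1; set s := coord G t1 / - coord D t1 in mt1.
have s0 : 0 <= s by rewrite divr_ge0 // oppr_ge0 ltW.
have pos t : 0 <= coord (comb 1 G s D) t.
  rewrite coord_comb mul1r.
  have [lt|ge] := ltP (coord D t) 0; last exact: addr_ge0 (G0 t) (mulr_ge0 s0 ge).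
  have := mt1 t lt; rewrite ler_pdivlMr ?oppr_gt0 //; lra.
have [pv pe] := (coord_ge0P _).1 pos.
have hG' : in_L2 (comb 1 G s D) by exact: in_L2_null.
have [|W vW leW] := IH (comb 1 G s D) _ hG'.
  rewrite ltnS in sk; apply: leq_trans sk; apply: proper_card; apply/properP; split.
    apply/fintype.subsetP => t; rewrite !inE coord_comb; apply: contra => /eqP z.
    by rewrite z (DG _ z); apply/eqP; ring.
  exists t1; rewrite !inE.
    by apply/negP => /eqP /DG z; rewrite z ltxx in Dt1.
  rewrite negbK coord_comb /s; apply/eqP; field.
  by rewrite lt_eqF.
exists W => //; apply: le_trans leW _; rewrite inner_comb mul1r gerDl.
by rewrite mulr_ge0_le0.
Qed.

Lemma pos_lower_bound (T : finType) (f : T -> R) :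
  exists2 s, 0 < s & forall t, 0 < f t -> s <= f t.
Proof.
(* The default 1 keeps the bound positive when [f] has no positive value. *)
exists (\big[Num.min/1]_(t | 0 < f t) f t).
  by apply/bigmin_gtP; split=> //; apply: ltr01.
by move=> t ft; apply: bigmin_le_cond.
Qed.

(** With equal supports, [V + s (V - W)] is feasible for small [s > 0], and [V] lies strictly
    between it and [W]; extremality forces [V = W]. *)
Lemma vertex_supp_inj V W : is_vertex V -> is_vertex W -> supp V = supp W -> V = W.
Proof.
move=> [hV xV] [hW _] eqs.
have [s s0 sV] := pos_lower_bound (coord V).
have pos t : 0 <= coord (comb 1 V s (comb 1 V (-1) W)) t.
  rewrite !coord_comb.
  have /andP[v0 v1] := in_L2_coord hV t; have /andP[w0 w1] := in_L2_coord hW t.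
  have [vt0|vt0] := eqVneq (coord V t) 0; last first.
    have := sV t; rewrite lt_def vt0 v0 => /(_ isT); nra.
  have : supp V t = supp W t by rewrite eqs.
  rewrite !ffunE vt0 eqxx /= => /esym /negbFE /eqP ->; lra.
have [pv pe] := (coord_ge0P _).1 pos.
have hA := in_L2_null hV (null_diff hV hW) pv pe.
have t01 : 0 < (1 + s)^-1 < 1.
  by rewrite invr_gt0 invf_lt1 ?ltrDl ?addr_gt0.
have E : V = mix (1 + s)^-1 (comb 1 V s (comb 1 V (-1) W)) W.
  by apply: marg_ext => [i x|e x y] /=; field; rewrite gt_eqF ?addr_gt0.
have AW := xV _ _ _ hA hW t01 E.
apply: coord_ext => t; have : coord (comb 1 V s (comb 1 V (-1) W)) t = coord W t by rewrite AW.
rewrite !coord_comb => h.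
have : (1 + s) * (coord V t - coord W t) = 0 by move: h; lra.
by move/eqP; rewrite mulf_eq0 gt_eqF ?addr_gt0 //= subr_eq0 => /eqP.
Qed.

Definition nonopt_vertex C V := is_vertex V /\ ~ opt_vertex src dst C V.

Lemma nonopt_gap C V W : opt_vertex src dst C V -> nonopt_vertex C W ->
  inner C V < inner C W.
Proof.
move=> [vV [hV oV]] [vW nW]; rewrite lt_neqAle oV ?andbT; last by case: vW.
apply/eqP => e; apply: nW; split=> //; split; first by case: vW.
by move=> H hH; rewrite -e oV.
Qed.

Lemma Delta_le_gap C V W : opt_vertex src dst C V -> nonopt_vertex C W ->
  Delta src dst C <= inner C W - inner C V.
Proof.
move=> oV [vW nW]; apply: ge_inf; last by exists W, V.
exists 0 => r [V1 [V2 [v1 [n1 [oV2 ->]]]]].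
by rewrite subr_ge0 ltW // nonopt_gap.
Qed.

(* A vertex is determined by its support, so there are finitely many of them. *)
Lemma Delta_gt0 C W : unique_opt_vertex src dst C -> nonopt_vertex C W ->
  0 < Delta src dst C.
Proof.
move=> [V0 [oV0 uV0]] nW.
pose P s V1 := nonopt_vertex C V1 /\ supp V1 = s.
(* The gap as a function on the finite type of supports; the default 0 for a support carried by no
   nonoptimal vertex is ignored by [pos_lower_bound]. *)
pose gap s := if pselect (exists V1, P s V1) is left h
  then inner C (projT1 (cid h)) - inner C V0 else 0.
have [e e0 he] := pos_lower_bound gap.
apply: lt_le_trans e0 _; apply: lb_le_inf.
  (* The infimum of the empty set is 0, so positivity needs a nonoptimal vertex [W]. *)
  by exists (inner C W - inner C V0); exists W, V0; case: nW.
move=> r [V1 [V2 [v1 [n1 [oV2 ->]]]]]; rewrite (uV0 _ oV2).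
have nV1 : nonopt_vertex C V1 by [].
have -> : inner C V1 - inner C V0 = gap (supp V1).
  rewrite /gap; case: pselect => [h|[]]; last by exists V1.
  case: cid => V' /= [[v' n'] s'].
  by rewrite (vertex_supp_inj v' v1 s').
apply: he; rewrite /gap; case: pselect => [h|[]]; last by exists V1.
by case: cid => V' /= [n' _]; rewrite subr_gt0 nonopt_gap.
Qed.

Lemma int01 (x : R) : x \is a Num.int -> 0 <= x <= 1 -> x = 0 \/ x = 1.
Proof.
move=> /intrP[z ->]; rewrite ler0z lerz1 => /andP[].
by case: z => [[|[|k]]|k] // _ _; [left|right].
Qed.

Lemma integral_coord G : integral G -> forall t, coord G t \is a Num.int.
Proof. by case=> hv he [p|p] /=. Qed.

(** The entries are 0 or 1, the extreme points of the interval that contains all entries of feasible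
    vectors. *)
Lemma integral_vertex G : in_L2 G -> integral G -> is_vertex G.
Proof.
move=> hG iG; split=> // A B t hA hB /andP[t0 t1] GAB; apply: coord_ext => s.
have E : coord G s = t * coord A s + (1 - t) * coord B s by rewrite GAB; case: (s).
have /andP[a0 a1] := in_L2_coord hA s; have /andP[b0 b1] := in_L2_coord hB s.
by case: (int01 (integral_coord iG s) (in_L2_coord hG s)) => h; rewrite h in E; nra.
Qed.

Definition assign (x : 'I_n -> 'I_d) : marg R n d m :=
  Marg (fun i a => (a == x i)%:R)
       (fun e a c => (a == x (src e))%:R * (c == x (dst e))%:R).

Lemma sum_delta (a : 'I_d) : \sum_(c < d) (c == a)%:R = 1 :> R.
Proof. by rewrite (bigD1 a) //= eqxx big1 ?addr0 // => c /negbTE ->. Qed.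

Lemma assign_L2 x : in_L2 (assign x).
Proof.
apply/in_L2P; split=> //= [i|b e a]; first exact: sum_delta.
case: b => /=; first by rewrite /colsum /= -mulr_suml sum_delta mul1r.
by rewrite /rowsum /= -mulr_sumr sum_delta mulr1.
Qed.

Lemma assign_integral x : integral (assign x).
Proof. by split=> * /=; rewrite ?rpredM ?natr_int. Qed.

Lemma inner_assign C x : inner C (assign x) = - map_objective src dst C x.
Proof.
rewrite /inner /map_objective opprD -!sumrN; congr (_ + _); apply: eq_bigr => i _.
  rewrite (bigD1 (x i)) //= eqxx mulr1 big1 ?addr0 ?opprK // => a /negbTE ->.
  by rewrite mulr0.
rewrite (bigD1 (x (src i))) //= [X in _ + X]big1 => [|a /negbTE ->]; last first.
  by rewrite big1 // => c _; rewrite mul0r mulr0.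
rewrite (bigD1 (x (dst i))) //= [X in _ + X + _]big1 => [|a /negbTE ->]; last first.
  by rewrite !mulr0.
by rewrite !eqxx !mulr1 !addr0 opprK.
Qed.

Lemma integral_assign G : in_L2 G -> integral G -> exists x, G = assign x.
Proof.
move=> hG iG; case/in_L2P: (hG) => gv ge gs gm.
have ex i : exists a, mv G i a = 1.
  apply: contrapT => h; have := gs i; rewrite big1; first by move/eqP; rewrite eq_sym oner_eq0.
  move=> a _; case: (int01 (integral_coord iG (inl (i, a))) (in_L2_coord hG (inl (i, a)))) => //= e.
  by case: h; exists a.
have [x hx] := choice ex.
have z i a : a != x i -> mv G i a = 0.
  move=> ne; have := gs i; rewrite (bigD1 (x i)) //= hx => /eqP.
  rewrite -subr_eq0 addrAC subrr add0r => /eqP h.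
  by apply: (psumr_eq0P _ h).
have zr e a c : a != x (src e) -> me G e a c = 0.
  move=> ne; have /= := gm false e a; rewrite z // => h.
  by apply: (psumr_eq0P _ h).
have zc e a c : c != x (dst e) -> me G e a c = 0.
  move=> ne; have /= := gm true e c; rewrite z // => h.
  by apply: (psumr_eq0P (P := predT) (F := fun a => me G e a c) _ h).
exists x; apply: marg_ext => [i a|e a c] /=.
  by case: eqVneq => [->|ne]; rewrite ?hx ?z.
case: eqVneq => [->|ne]; last by rewrite mul0r zr.
rewrite mul1r; case: eqVneq => [->|ne]; last by rewrite zc.
have /= := gm false e (x (src e)); rewrite hx /rowsum (bigD1 (x (dst e))) //= big1 ?addr0 //.
by move=> c' ne; rewrite zc.
Qed.

(** Tilt the cost by [Delta] times the entry [(i, a)]. The tilted cost of [V] is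
    [inner C V + Delta], and every other vertex reaches at least this through its gap;
    [vertex_below] extends the bound to [G] without a decomposition into vertices. *)
Lemma lp_gap C V G i a : unique_opt_vertex src dst C -> opt_vertex src dst C V ->
  0 <= Delta src dst C -> mv V i a = 1 -> in_L2 G ->
  Delta src dst C * (1 - mv G i a) <= inner C G - inner C V.
Proof.
move=> [V0 [_ uV]] oV De0 Va hG; set De := Delta _ _ _ in De0 *.
pose I := Marg (fun j b => ((j == i) && (b == a))%:R) (fun _ _ _ => 0) : marg R n d m.
have II H : inner I H = mv H i a.
  rewrite /inner [X in _ + X]big1 ?addr0 => [|e _]; last first.
    by rewrite big1 // => x _; rewrite big1 // => y _; rewrite mul0r.
  rewrite (bigD1 i) //= [X in _ + X]big1 ?addr0 => [|j /negbTE ->]; last first.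
    by rewrite big1 // => x _; rewrite mul0r.
  rewrite (bigD1 a) //= [X in _ + X]big1 ?addr0 => [|j /negbTE ->]; last first.
    by rewrite andbF mul0r.
  by rewrite !eqxx mul1r.
have FE H : inner (comb 1 C De I) H = inner C H + De * mv H i a.
  by rewrite innerC inner_comb mul1r -(innerC C) -(innerC I) II.
have [W vW] := vertex_below (comb 1 C De I) hG; rewrite !FE => le.
have [oW|nW] := pselect (opt_vertex src dst C W).
  by move: le; rewrite (uV _ oW) -(uV _ oV) Va; lra.
have := @Delta_le_gap C V W oV (conj vW nW); rewrite -/De.
have /andP[/= w0 _] := in_L2_coord vW.1 (inl (i, a)).
have := mulr_ge0 De0 w0; lra.
Qed.

End LocalPolytope.

(** * Near-optimality at the stopping time and correctness of the rounding *)

Section Rounding.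
Variables (R : realType) (n d m : nat) (src dst : 'I_m -> 'I_n).
Variables (C : marg R n d m) (eta eps : R).
Hypothesis d0 : forall i : 'I_n, (0 < d)%N.
Implicit Types (G V Z : marg R n d m).

Local Notation endpoint := (endpoint src dst).
Local Notation viol := (viol src dst).
Local Notation emp_inv := (emp_inv src dst C eta).
Local Notation stopped := (stopped src dst).
Local Notation in_L2 := (in_L2 src dst).

Definition prob Z :=
  (forall i x, 0 <= mv Z i x) /\ (forall e x y, 0 <= me Z e x y) /\ normalized Z.

Lemma in_L2_prob Z : in_L2 Z -> prob Z.
Proof.
move=> /in_L2P[zv ze zs zm]; split=> //; split=> //; split=> // e.
rewrite -(sum_edge_marg1 false) -(zs (src e)).
by apply: eq_bigr => x _; rewrite zm.
Qed.

Lemma normInf_mv i x : `|mv C i x| <= normInf C.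
Proof.
rewrite le_max; apply/orP; left; apply: le_trans (le_bigmax _ _ i).
exact: (le_bigmax _ (fun x => `|mv C i x|) x).
Qed.

Lemma normInf_me e x y : `|me C e x y| <= normInf C.
Proof.
rewrite le_max; apply/orP; right; apply: le_trans (le_bigmax _ _ e).
apply: le_trans (le_bigmax _ _ x).
exact: (le_bigmax _ (fun y => `|me C e x y|) y).
Qed.

Lemma inner_prob_le Z : prob Z -> `|inner C Z| <= normInf C * (n%:R + m%:R).
Proof.
move=> [zv [ze [nv ne]]]; apply: le_trans (ler_normD _ _) _; rewrite mulrDr.
apply: lerD; apply: le_trans (ler_norm_sum _ _ _) _.
  rewrite -[X in _ * X%:R](card_ord n) mulr_natr -sumr_const; apply: ler_sum => i _.
  apply: le_trans (ler_norm_sum _ _ _) _.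
  rewrite -[normInf C]mulr1 -(nv i) mulr_sumr; apply: ler_sum => x _.
  by rewrite normrM (ger0_norm (zv i x)) ler_wpM2r ?normInf_mv.
rewrite -[X in _ * X%:R](card_ord m) mulr_natr -sumr_const; apply: ler_sum => e _.
apply: le_trans (ler_norm_sum _ _ _) _.
rewrite -[normInf C]mulr1 -(ne e) mulr_sumr; apply: ler_sum => x _.
apply: le_trans (ler_norm_sum _ _ _) _; rewrite mulr_sumr; apply: ler_sum => y _.
by rewrite normrM (ger0_norm (ze e x y)) ler_wpM2r ?normInf_me.
Qed.

Lemma inner_comb_prob (t : R) V Z : 0 <= t -> prob V -> prob Z ->
  `|inner C (comb (1 - t) V t Z) - inner C V| <= 2 * t * normInf C * (n%:R + m%:R).
Proof.
move=> t0 /inner_prob_le hV /inner_prob_le hZ; rewrite inner_comb.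
have -> : (1 - t) * inner C V + t * inner C Z - inner C V
    = t * (inner C Z - inner C V) by ring.
rewrite normrM (ger0_norm t0) -!mulrA [X in _ <= X]mulrCA; apply: ler_wpM2l => //.
by apply: le_trans (ler_normB _ _) _; lra.
Qed.

Definition slack G b e x := edge_marg b G e x - mv G (endpoint b e) x.

(** Uniform vertices and product edges, built so that each slack is [c] times that of [G]; mixing
    with it adjusts the violations of a vector while keeping all masses. *)
Definition slack_product G (c : R) : marg R n d m :=
  Marg (fun _ _ => d%:R^-1)
       (fun e x y => (d%:R^-1 + c * slack G false e x) * (d%:R^-1 + c * slack G true e y)).

Lemma slack_sum G b e : normalized G -> \sum_x slack G b e x = 0.
Proof. by move=> [nv ne]; rewrite sumrB sum_edge_marg1 ne nv subrr. Qed.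

Lemma slack_shift_sum G b e c : normalized G ->
  \sum_x (d%:R^-1 + c * slack G b e x) = 1.
Proof.
move=> nG; rewrite big_split /= -mulr_sumr slack_sum // mulr0 addr0.
exact: (uniform_sum R m d0 (src e)).
Qed.

Lemma slack_product_marg G c b e x : normalized G ->
  edge_marg b (slack_product G c) e x = d%:R^-1 + c * slack G b e x.
Proof.
move=> nG; case: b => /=.
  by rewrite /colsum /= -mulr_suml slack_shift_sum // mul1r.
by rewrite /rowsum /= -mulr_sumr slack_shift_sum // mulr1.
Qed.

Lemma slack_le G b e x : stopped eps G -> `|slack G b e x| <= eps.
Proof.
move=> /(_ e)[vl vr].
have : viol b G e < eps by case: (b).
move=> /ltW; apply: le_trans; rewrite /viol (bigD1 x) //= lerDl.
exact: sumr_ge0.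
Qed.

Lemma slack_product_prob G c : normalized G -> stopped eps G ->
  `|c| * eps <= d%:R^-1 -> prob (slack_product G c).
Proof.
move=> nG sG hc.
have pos b e x : 0 <= d%:R^-1 + c * slack G b e x.
  have : `|c * slack G b e x| <= d%:R^-1.
    by rewrite normrM; apply: le_trans hc; rewrite ler_wpM2l // slack_le.
  by rewrite ler_norml => /andP[]; lra.
split=> [i x|]; first by rewrite invr_ge0.
split=> [e x y|]; last split=> [i|e]; [exact: mulr_ge0|exact: (uniform_sum R m d0)|].
rewrite -(sum_edge_marg1 false); under eq_bigr do rewrite slack_product_marg //.
exact: slack_shift_sum.
Qed.

(* [G] is an exact minimiser of the entropic objective over the polytope with the
   right-hand sides shifted by its own violations, so it competes with a point [V'] of
   that shifted polytope near [V]; conversely [G] is near a point of the local polytope. *)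
Lemma stopped_near_optimal G V : emp_inv G -> stopped eps G -> in_L2 V ->
  0 < eps -> 0 <= eta -> (0 < d)%N -> d%:R * eps <= 1 ->
  exists G', [/\ in_L2 G', forall i a, mv G' i a <= mv G i a + d%:R * eps &
    eta * (inner C G' - inner C V) <=
    (n%:R + 2 * m%:R) * ln d%:R
    + 4 * (eta * normInf C * (d%:R * eps)) * (n%:R + m%:R)].
Proof.
move=> [pG nG gG] sG hV eps0 eta0 dp tau1; set tau := d%:R * eps in tau1 *.
have dr : 0 < d%:R :> R by rewrite ltr0n.
have tau0 : 0 < tau by rewrite mulr_gt0.
have [pv pe] := pG; have [nv ne] := nG.
have prG : prob G by do 2 (split=> [*|]; first exact: ltW).
have tauE : tau^-1 * eps = d%:R^-1.
  by rewrite /tau; field; rewrite !gt_eqF.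
(* Mixed in with weight [tau], the first coefficient gives [V] the violations of [G], and the second
   cancels those of [G]. *)
pose Q1 := slack_product G tau^-1.
pose Q2 := slack_product G (- ((1 - tau) / tau)).
have pr1 : prob Q1.
  by apply: slack_product_prob => //; rewrite gtr0_norm ?invr_gt0 // tauE.
have pr2 : prob Q2.
  apply: slack_product_prob => //.
  rewrite normrN ger0_norm ?divr_ge0 ?subr_ge0 ?(ltW tau0) // -mulrA tauE.
  by rewrite -[X in _ <= X]mul1r ler_wpM2r ?invr_ge0 // gerBl ltW.
pose V' := comb (1 - tau) V tau Q1.
pose G' := comb (1 - tau) G tau Q2.
have [vv [ve [vs vm]]] := in_L2_prob hV.
case/in_L2P: (hV) => _ _ _ mV.
have t1 : 0 <= 1 - tau by rewrite subr_ge0.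
have nD : null src dst (comb 1 V' (-1) G).
  split=> [i|b e x].
    rewrite big_split /= -!mulr_sumr big_split /= -!mulr_sumr vs nv.
    have [_ [_ [q2 _]]] := pr1; have /= -> := q2 i; ring.
  rewrite !edge_marg_comb slack_product_marg // mV /= /slack.
  by field; rewrite !gt_eqF.
have hG' : in_L2 G'.
  have [q0 [q1 [q2 q3]]] := pr2.
  apply/in_L2P; split=> [i x|e x y|i|b e x].
  - by rewrite addr_ge0 ?mulr_ge0 // ltW.
  - by rewrite /= addr_ge0 // mulr_ge0 ?(ltW tau0) ?q1 // ltW.
  - by rewrite big_split /= -!mulr_sumr nv; have /= -> := q2 i; ring.
  rewrite edge_marg_comb slack_product_marg // /slack /=.
  by field; rewrite !gt_eqF.
exists G'; split=> // [i a|].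
  rewrite /= -/tau.
  have : tau * d%:R^-1 <= tau.
    by rewrite -[X in _ <= X]mulr1 ler_wpM2l ?(ltW tau0) // invf_le1 // ler1n.
  have := mulr_ge0 (ltW tau0) (ltW (pv i a)); lra.
(* Along [V' - G] the Gibbs property reads [eta (<C,G> - <C,V'>) = <log G,V'> - <log G,G>], which is
   at most the entropy of [G]. *)
have := gG _ nD; rewrite (inner_comb (logm G) 1 V') (inner_comb C 1 V') => gibbsD.
have logV' : inner (logm G) V' <= 0.
  have [q0 [q1 _]] := pr1.
  apply: inner_logm_le0 => // *; apply: addr_ge0; apply: mulr_ge0 => //; exact: ltW.
have ent := marg_entropy_le pG nG.
have := inner_comb_prob (ltW tau0) (in_L2_prob hV) pr1.
have := inner_comb_prob (ltW tau0) prG pr2.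
rewrite -/V' -/G' !ler_norml => /andP[_ hG2] /andP[_ hV2].
have := ler_wpM2l eta0 hG2; have := ler_wpM2l eta0 hV2.
set N := normInf C; set X := ln d%:R in ent *; move: gibbsD ent logV'.
set a1 := inner (logm G) V'; set a2 := inner (logm G) G.
set c1 := inner C V'; set c2 := inner C G; set c3 := inner C G'; set c4 := inner C V.
move=> h1 h2 h3 h4 h5.
have -> : eta * (c3 - c4) = eta * (c3 - c2) + eta * (c2 - c1) + eta * (c1 - c4) by ring.
have -> : 4 * (eta * N * tau) * (n%:R + m%:R)
  = eta * (2 * tau * N * (n%:R + m%:R)) + eta * (2 * tau * N * (n%:R + m%:R)) by ring.
have h6 : eta * (c2 - c1) <= (n%:R + 2 * m%:R) * X by move: h1 h2 h3; lra.
lra.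
Qed.

Hypothesis sg : simple_graph src dst.

Lemma vertices_le_double_edges : (n <= 2 * m)%N.
Proof.
have [_ [_ cov]] := sg.
have ex i : exists p : bool * 'I_m, endpoint p.1 p.2 = i.
  by have [e [h|h]] := cov i; [exists (false, e)|exists (true, e)].
have [f hf] := choice ex.
have inj : injective f by move=> i j /(congr1 (fun p => endpoint p.1 p.2)); rewrite !hf.
by have := leq_card f inj; rewrite card_prod card_bool !card_ord.
Qed.

Lemma maxdeg_gt0 (i : 'I_n) : (0 < maxdeg src dst)%N.
Proof.
have [_ [_ cov]] := sg; have [e he] := cov i.
apply: leq_trans (leq_bigmax i); rewrite -count_incident -has_count.
by apply/hasP; exists e; rewrite ?mem_enum //; apply/orP; case: he => ->; [left|right].
Qed.

Hypothesis eta_large :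
  eta >= (2 * ln (16 * n%:R ^+ 2 * d%:R ^+ 2) + 16 * m%:R * d%:R ^+ 2)
           / Num.min (Delta src dst C) (1 / 128).
Hypothesis eps_small :
  eps^-1 > (25 * d%:R * (maxdeg src dst)%:R * m%:R) ^+ 2
           * Num.max (eta * normInf C) 68.

Lemma eps_gt0 : 0 < eps.
Proof.
rewrite -invr_gt0; apply: le_lt_trans eps_small.
by rewrite mulr_ge0 ?sqr_ge0 // le_max ler0n orbT.
Qed.

Hypothesis tC : tight src dst C.
Hypothesis uC : unique_opt_vertex src dst C.

(** The condition on [eta] gives [eta * Delta >= 16 m d^2], against an entropy term of at most
    [m d^2] and an error of at most [1 / 50]. Thus the nearby feasible [G'] has weight at least
    [9 / 10] at [(i, a)], and passing back to [G] costs at most [1 / 100]. *)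
Lemma stopped_marginal_gt_half G (V : marg R n d m) i a : emp_inv G -> stopped eps G ->
  opt_vertex src dst C V -> mv V i a = 1 -> (1 < d)%N -> 0 < Delta src dst C ->
  1 / 2 < mv G i a.
Proof.
move=> iG sG oV Va d1 De0; set De := Delta src dst C in De0 *.
have dp := d0 i; have eps0 := eps_gt0.
have n1 : 1 <= n%:R :> R by rewrite ler1n (leq_ltn_trans _ (ltn_ord i)).
have d2 : 2 <= d%:R :> R by rewrite (ler_nat _ 2).
have g1 : 1 <= (maxdeg src dst)%:R :> R by rewrite ler1n (maxdeg_gt0 i).
have n2m : n%:R <= 2 * m%:R :> R by rewrite -natrM ler_nat vertices_le_double_edges.
have m1 : 1 <= m%:R :> R.
  rewrite ler1n lt0n; apply/eqP => m0; move: n2m n1; rewrite m0; lra.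
have lge0 : 0 <= ln (16 * n%:R ^+ 2 * d%:R ^+ 2) :> R.
  apply: ln_ge0; rewrite -mulrA -exprMn.
  have : 1 <= n%:R * d%:R :> R by nra.
  nra.
have md4 : 4 <= m%:R * d%:R ^+ 2 :> R by nra.
have E16 : 16 * m%:R * d%:R ^+ 2 = 16 * (m%:R * d%:R ^+ 2) :> R by ring.
have mn0 : 0 < Num.min De (1 / 128) by rewrite lt_min De0; lra.
have eta0 : 0 <= eta.
  apply: le_trans eta_large; rewrite divr_ge0 ?(ltW mn0) //.
  by rewrite E16; lra.
have etaDe : 16 * (m%:R * d%:R ^+ 2) <= eta * De.
  have : eta * Num.min De (1 / 128) <= eta * De.
    by rewrite ler_wpM2l // ge_min lexx.
  apply: le_trans; move: eta_large; rewrite ler_pdivrMr //; apply: le_trans.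
  by rewrite E16; lra.
have N0 : 0 <= normInf C by apply: le_trans (normInf_mv i a).
have epsS := eps_small; set K := (25 * d%:R * (maxdeg src dst)%:R * m%:R) ^+ 2 in epsS.
have Kge : 625 * (d%:R * m%:R) <= K.
  have p1 : 1 <= d%:R * m%:R :> R by nra.
  have p2 : 25 * (d%:R * m%:R) <= 25 * d%:R * (maxdeg src dst)%:R * m%:R :> R.
    have -> : 25 * d%:R * (maxdeg src dst)%:R * m%:R
      = 25 * (d%:R * m%:R * (maxdeg src dst)%:R) :> R by ring.
    by rewrite ler_wpM2l // ler_peMr // mulr_ge0.
  rewrite /K; nra.
have K0 : 0 < K by apply: lt_le_trans Kge; nra.
have Keps M : M <= Num.max (eta * normInf C) 68 -> K * M * eps <= 1.
  move=> leM; rewrite -ler_pdivlMr // mul1r; apply: ltW; apply: le_lt_trans epsS.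
  by rewrite ler_wpM2l // ltW.
have K1 := Keps (eta * normInf C); have K2 := Keps 68.
rewrite !le_max !lexx orbT /= in K1 K2; move: (K1 isT) (K2 isT) => {}K1 {}K2.
have tau_le : d%:R * eps <= 1 / 100.
  have q1 : d%:R <= d%:R * m%:R :> R by nra.
  have : 625 * (d%:R * m%:R) * 68 * eps <= K * 68 * eps.
    by rewrite ler_wpM2r ?(ltW eps0) // ler_wpM2r.
  have : d%:R * eps <= d%:R * m%:R * eps by rewrite ler_wpM2r // ltW.
  nra.
have err_le : 4 * (eta * normInf C * (d%:R * eps)) * (3 * m%:R) <= 1 / 50.
  have q0 : 0 <= eta * normInf C by rewrite mulr_ge0.
  have : 625 * (d%:R * m%:R) * (eta * normInf C) * eps <= K * (eta * normInf C) * eps.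
    by rewrite ler_wpM2r ?(ltW eps0) // ler_wpM2r.
  have -> : 4 * (eta * normInf C * (d%:R * eps)) * (3 * m%:R)
     = 12 * (d%:R * m%:R * (eta * normInf C) * eps) by ring.
  have -> : 625 * (d%:R * m%:R) * (eta * normInf C) * eps
     = 625 * (d%:R * m%:R * (eta * normInf C) * eps) by ring.
  lra.
have hV : in_L2 V by case: oV => [[]].
have tau1 : d%:R * eps <= 1 by lra.
have [G' [hG' leG hgap]] := stopped_near_optimal iG sG hV eps0 eta0 dp tau1.
have gap := ler_wpM2l eta0 (lp_gap uC oV (ltW De0) Va hG'); rewrite -/De in gap.
have lnd : ln d%:R <= d%:R - 1 :> R by apply: ln_le_subr1; lra.
have ent : (n%:R + 2 * m%:R) * ln d%:R <= 4 * m%:R * (d%:R - 1) :> R.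
  apply: ler_pM => //; [apply: ln_ge0; lra|lra].
have err : 4 * (eta * normInf C * (d%:R * eps)) * (n%:R + m%:R) <= 1 / 50.
  apply: le_trans err_le; rewrite ler_wpM2l //; last lra.
  by rewrite !mulr_ge0 // ltW.
have g'1 : 0 <= 1 - mv G' i a by rewrite subr_ge0; case: (in_L2_le1 hG').
have main : 16 * (m%:R * d%:R ^+ 2) * (1 - mv G' i a) <= 4 * m%:R * (d%:R - 1) + 1 / 50.
  apply: (@le_trans _ _ (eta * De * (1 - mv G' i a))); first by rewrite ler_wpM2r.
  rewrite -mulrA; apply: le_trans gap (le_trans hgap _); exact: lerD.
have dd : d%:R - 1 <= d%:R ^+ 2 / 4 :> R by have := sqr_ge0 (d%:R - 2 : R); nra.
have mdd : 4 * m%:R * (d%:R - 1) <= m%:R * d%:R ^+ 2 :> R by nra.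
have : mv G' i a >= 9 / 10.
  rewrite leNgt; apply/negP => lt; move: main mdd md4.
  set Y := m%:R * d%:R ^+ 2; nra.
have := leG i a; lra.
Qed.

(** If [x] differed from the integral optimum [xs] at [i], the state [xs i] would carry more than
    half of the mass of [G] at [i], and [x i], being a maximiser, at least as much again. *)
Lemma stopped_rounding_MAP G x : emp_inv G -> stopped eps G ->
  is_rounding G x -> is_MAP src dst C x.
Proof.
move=> iG sG rx.
have [V [oV iV]] := tC; have [hV optV] := oV.
have [xs Vxs] := integral_assign hV iV.
have vV := integral_vertex hV iV.
have MAPxs : is_MAP src dst C xs.
  move=> y; have := optV _ (assign_L2 R src dst y).
  by rewrite Vxs !inner_assign lerN2.
suff -> : x = xs by [].
apply/funext => i; apply/eqP; apply: contraT => ne.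
have oVx : opt_vertex src dst C V by split.
have d1 : (1 < d)%N.
  rewrite ltn_neqAle (d0 i) andbT; apply/eqP => d1; move/negP: ne; apply.
  have z (y : 'I_d) : y = 0%N :> nat.
    by apply/eqP; rewrite -leqn0 -ltnS [X in (_ < X)%N]d1.
  by apply/eqP/val_inj; rewrite /= !z.
(* The assignment of [x] is a vertex other than the unique optimal one, which makes [Delta]
   positive. *)
have De0 : 0 < Delta src dst C.
  have [V0 [_ uV]] := uC.
  apply: (@Delta_gt0 _ _ _ _ _ _ _ (assign R src dst x)) => //; split.
    by apply: integral_vertex; [exact: assign_L2|exact: assign_integral].
  move=> /uV e; have := uV _ oVx; rewrite -e Vxs => /(congr1 (fun W => mv W i (x i))) /=.
  by rewrite eqxx (negbTE ne) => /eqP; rewrite eq_sym oner_eq0.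
have half := @stopped_marginal_gt_half G V i (xs i) iG sG oVx _ d1 De0.
have [pG [nv _] _] := iG; have := nv i.
have Vi : mv V i (xs i) = 1 by rewrite Vxs /= eqxx.
have := half Vi; have := rx i (xs i) => le lt.
rewrite (bigD1 (x i)) //= (bigD1 (xs i)) /=; last by rewrite eq_sym.
have : 0 <= \sum_(j < d | (j != x i) && (j != xs i)) mv G i j.
  by apply: sumr_ge0 => j _; apply/ltW; case: pG.
lra.
Qed.

(** Driver shared by both schedules: every iteration before the stop lowers the potential by
    [delta], starting from [S0]. Descent is asked only before the stop because a greedy trajectory
    is unconstrained afterwards. *)
Lemma descent_returns_MAP traj (delta K : R) : 0 < delta -> S0 C eta / delta <= K ->
  traj 0%N = emp_init C eta ->
  (forall t, emp_inv (traj t) -> ~ stopped eps (traj t) ->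
     emp_inv (traj t.+1) /\ pot (traj t.+1) + delta <= pot (traj t)) ->
  returns_MAP_within src dst C eps traj K.
Proof.
move=> dl leK tr0 tr.
have inv t : (forall s, (s < t)%N -> ~ stopped eps (traj s)) ->
    emp_inv (traj t) /\ pot (traj t) + t%:R * delta <= S0 C eta.
  elim: t => [|t IH] ns.
    by rewrite tr0 mul0r addr0 (S0E src dst C eta d0) lexx; split=> //; apply: emp_inv_init.
  have [it pt] := IH (fun s st => ns s (ltnW st)).
  have [it' pt'] := tr t it (ns t (ltnSn t)); split=> //.
  by rewrite -natr1 mulrDl mul1r; lra.
have [t ns|t [st nt tS]] := @first_stop R (fun t => stopped eps (traj t)) delta (S0 C eta) dl.
  have [[pG nG _] le] := inv t ns; have := pot_ge0 pG nG; lra.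
exists t; split; [|split=> //; split=> // x].
  rewrite -(ler_int R); apply: le_trans (ceil_ge _); apply: le_trans leK.
  by rewrite ler_pdivlMr.
by apply: stopped_rounding_MAP => //; case: (inv t nt).
Qed.

Lemma not_stopped_viol G : ~ stopped eps G -> exists b e, eps <= viol b G e.
Proof.
move=> ns; apply: contrapT => h; apply: ns => e; split; rewrite ltNge; apply/negP => le;
  apply: h; [by exists false, e|by exists true, e].
Qed.

End Rounding.

(** * Iteration bounds for the two schedules *)

Theorem theorem3 (R : realType) (n d m : nat) (src dst : 'I_m -> 'I_n)
  (C : marg R n d m) (eta eps : R) :
  simple_graph src dst ->
  eta >= (2 * ln (16 * n%:R ^+ 2 * d%:R ^+ 2) + 16 * m%:R * d%:R ^+ 2)
           / Num.min (Delta src dst C) (1 / 128) ->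
  eps^-1 > (25 * d%:R * (maxdeg src dst)%:R * m%:R) ^+ 2
           * Num.max (eta * normInf C) 68 ->
  tight src dst C ->
  unique_opt_vertex src dst C ->
  returns_MAP_within src dst C eps (cyclic_traj src dst C eta)
     (4 * S0 C eta * ((maxdeg src dst)%:R + 1) / eps ^+ 2)
  /\
  (forall traj, greedy_traj src dst C eta eps traj ->
     returns_MAP_within src dst C eps traj (4 * S0 C eta / eps ^+ 2)).
Proof.
move=> sg etaL epsS tC uC.
have d0 (i : 'I_n) : (0 < d)%N.
  by have [V [[[_ [_ [sV _]]] _] _]] := tC; apply: sum1_ord_gt0 (sV i).
have eps0 : 0 < eps by exact: eps_gt0 epsS.
have e20 : 0 < eps ^+ 2 by rewrite exprn_gt0.
have epsV (G : marg R n d m) b e : eps <= viol src dst b G e -> eps ^+ 2 <= viol src dst b G e ^+ 2.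
  by move=> le; rewrite ler_pXn2r ?nnegrE ?(ltW eps0) //; apply: sumr_ge0.
split=> [|traj [tr0 tr]].
  set g := (maxdeg src dst)%:R + 1.
  have g0 : 0 < g by rewrite /g ltr_wpDl.
  apply: (@descent_returns_MAP R n d m src dst C eta eps d0 sg etaL epsS tC uC _
    (eps ^+ 2 / (4 * g))) => //.
  - by rewrite divr_gt0 // mulr_gt0.
  - rewrite le_eqVlt; apply/orP; left; apply/eqP; field.
    by rewrite !gt_eqF.
  - move=> t it ns; split; first exact: emp_inv_sweep.
    (* Some violation at the start of the sweep is at least [eps]; [viol_cyclic] converts it into
       the drop over the whole sweep. *)
    have [b [e /epsV le]] := not_stopped_viol ns.
    have [nl _] := sg.
    rewrite addrC -lerBrDr ler_pdivrMr ?mulr_gt0 // mulrC.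
    exact: le_trans le (viol_cyclic d0 nl b e it).
apply: (@descent_returns_MAP R n d m src dst C eta eps d0 sg etaL epsS tC uC _
  (eps ^+ 2 / 4)) => //.
- by rewrite divr_gt0.
- rewrite le_eqVlt; apply/orP; left; apply/eqP; field.
  by rewrite gt_eqF.
move=> t it ns; have [f [side [mx ->]]] := tr t ns.
have -> : (if side then right_step dst (traj t) f else left_step src (traj t) f)
  = step src dst side (traj t) f by [].
split; first exact: emp_inv_step.
have [pG nG _] := it; rewrite (pot_step src dst d0) //.
have [b [e le]] := not_stopped_viol ns.
(* The greedy choice maximises over all edges and sides, so its violation is at least [eps] too. *)
have le' : eps <= viol src dst side (traj t) f.
  apply: le_trans le _; have := mx e; rewrite ge_max => /andP[].
  by case: (b); case: (side).
rewrite -addrA gerDl addrC subr_le0 ler_pdivrMr // mulrC.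
exact: le_trans (epsV _ _ _ le') (viol_le_gain src dst d0 side f pG nG).
Qed.
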